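(* Let $Q_t$ be the number in system of an infinite server queue with periodic arrival rate $\lambda+\sum_{k=1}^\infty a_k\cos(kt)+b_k\sin(kt)>0$, arrival batch size $n\in\mathbb{Z}^+$, and exponential service rate $\mu>0$. Then the mean and variance of the queue are given by $$\mathbb{E}[Q_t]=Q_0e^{-\mu t}+\frac{n\lambda}{\mu}(1-e^{-\mu t})+\sum_{k=1}^\infty\frac{n(a_k\mu-b_kk)}{k^2+\mu^2}\left(\cos(kt)-e^{-\mu t}\right)+\sum_{k=1}^\infty\frac{n(a_kk+b_k\mu)}{k^2+\mu^2}\sin(kt),$$ $$\mathrm{Var}(Q_t)=Q_0(e^{-\mu t}-e^{-2\mu t})+\frac{n\lambda}{\mu}(1-e^{-\mu t})+\sum_{k=1}^\infty\frac{n(a_k\mu-b_kk)}{k^2+\mu^2}\left(\cos(kt)-e^{-\mu t}\right)+\sum_{k=1}^\infty\frac{n(a_kk+b_k\mu)}{k^2+\mu^2}\sin(kt)$$ $$+\frac{n(n-1)\lambda}{2\mu}(1-e^{-2\mu t})+\sum_{k=1}^\infty\frac{n(n-1)(2a_k\mu-b_kk)}{k^2+4\mu^2}\left(\cos(kt)-e^{-2\mu t}\right)+\sum_{k=1}^\infty\frac{n(n-1)(a_kk+2b_k\mu)}{k^2+4\mu^2}\sin(kt)$$ for all $t\ge0$, where $Q_0$ is the initial number in system.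
   Context: Model: batches of exactly $n$ customers arrive at the epochs of a non-homogeneous Poisson process whose intensity at time $t$ is the stated periodic function, i.e. a positive, locally integrable $2\pi$-periodic function given by its Fourier series with real coefficients $\lambda,a_k,b_k$. There are infinitely many servers, so each customer starts service immediately and leaves after an independent $\mathrm{Exp}(\mu)$ service time. $Q_t$ is the number of customers present at time $t$: the time-inhomogeneous Markov chain on $\{0,1,2,\dots\}$ with transitions $q\to q+n$ at rate equal to the arrival intensity and $q\to q-1$ at rate $\mu q$. $Q_0$ is a deterministic non-negative integer. *)

(* Defs.v *)
From HB Require Import structures.
From mathcomp Require Import all_boot all_order all_algebra.
From mathcomp Require Import all_classical all_reals all_analysis.

Set Implicit Arguments.
Unset Strict Implicit.
Unset Printing Implicit Defensive.

Import Order.TTheory GRing.Theory Num.Theory.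
Import numFieldNormedType.Exports.

Local Open Scope classical_set_scope.
Local Open Scope ring_scope.

(* Mutual independence of the families of events [F i], [i : I]: the product
   rule holds for every choice of one event per index in a finite set. *)
Definition mutually_independent d (T : measurableType d) (R : realType)
    (P : probability T R) (I : eqType) (F : I -> set_system T) : Prop :=
  (forall i, F i `<=` measurable) /\
  (forall (J : seq I) (E : I -> set T), uniq J ->
     (forall i, i \in J -> F i (E i)) ->
     P (\bigcap_(i in [set` J]) E i) = (\prod_(i <- J) fine (P (E i)))%:E).

Definition sigma_of d (T : Type) (U : measurableType d) (X : T -> U) :
    set_system T :=
  preimage_set_system [set: T] X measurable.

Definition sigma_of_seq (T : Type) (R : realType) (X : nat -> T -> R) :
    set_system T :=
  <<s \bigcup_j sigma_of (X j) >>.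

(* [A j w] is the epoch of the (j+1)-st arrival and [N t w] the number of
   arrival epochs in ]0, t]; the second clause says that the (j+1)-st arrival
   has occurred by time t iff N_t >= j+1. *)
Definition poisson_arrivals d (T : measurableType d) (R : realType)
    (P : probability T R) (lam : R -> R)
    (A : nat -> T -> R) (N : R -> T -> nat) : Prop :=
  [/\ forall w, N 0 w = 0%N,
      forall t j w, 0 <= t -> (A j w <= t) = (j < N t w)%N,
      forall s t k, 0 <= s -> s <= t ->
        let m := \int[lebesgue_measure]_(x in `]s, t]) lam x in
        P [set w | (N t w - N s w)%N = k] = (m ^+ k / k`!%:R * expR (- m))%:E
    & forall u : nat -> R, 0 <= u 0%N -> {homo u : i j / (i <= j)%N >-> i <= j} ->
        mutually_independent P
          (fun i => sigma_of (fun w => (N (u i.+1) w - N (u i) w)%N))].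

(* The customers: [inl i] are the q0 customers present at time 0, and
   [inr (j, i)] is the i-th member of the j-th batch. *)
Definition customer (q0 n : nat) : eqType := ('I_q0 + nat * 'I_n)%type.

(* [S c] is the service time of customer [c], except that for a customer
   present at time 0 it is the remaining service time, which is again Exp(mu) by
   the memoryless property.  In the independence clause the index [None] stands
   for the whole arrival process. *)
Definition exponential_services d (T : measurableType d) (R : realType)
    (P : probability T R) (mu : R) (n q0 : nat)
    (A : nat -> T -> R) (S : customer q0 n -> T -> R) : Prop :=
  (forall c B, measurable B -> P (S c @^-1` B) = exponential_prob mu B) /\
  mutually_independent P
    (fun c : option (customer q0 n) =>
       if c is Some c' then sigma_of (S c') else sigma_of_seq A).

Definition number_in_system (T : Type) (R : realType) (n q0 : nat)
    (A : nat -> T -> R) (N : R -> T -> nat) (S : customer q0 n -> T -> R)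
    (t : R) (w : T) : nat :=
  (\sum_(i < q0) (t < S (inl i) w)%R
   + \sum_(j < N t w) \sum_(i < n)
       (t < A j w + S (inr (nat_of_ord j, i)) w)%R)%N.

(* Q is the number in system of the infinite server queue in which batches of n
   customers arrive at the epochs of a Poisson process of intensity [lam], with
   Exp(mu) service times and q0 customers initially present. *)
Definition batch_infinite_server_queue d (T : measurableType d) (R : realType)
    (P : probability T R) (lam : R -> R) (n : nat) (mu : R) (q0 : nat)
    (Q : R -> T -> nat) : Prop :=
  exists (A : nat -> T -> R) (N : R -> T -> nat) (S : customer q0 n -> T -> R),
    [/\ poisson_arrivals P lam A N,
        exponential_services P mu A S
      & forall t w, 0 <= t -> Q t w = number_in_system A N S t w].

(* The Fourier series of f is l + \sum_(k >= 1) (a k cos(k x) + b k sin(k x)).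
   No pointwise convergence of this series is assumed: it need not hold for a
   merely integrable f. *)
Definition has_fourier_series (R : realType) (f : R -> R)
    (l : R) (a b : nat -> R) : Prop :=
  [/\ l = (2 * pi)^-1 * \int[lebesgue_measure]_(x in `[0, 2 * pi]) f x,
      forall k, (0 < k)%N -> a k =
        pi^-1 * \int[lebesgue_measure]_(x in `[0, 2 * pi]) (f x * cos (k%:R * x))
    & forall k, (0 < k)%N -> b k =
        pi^-1 * \int[lebesgue_measure]_(x in `[0, 2 * pi]) (f x * sin (k%:R * x))].

(* [sum_from1 u] is meaningful only when [summable_from1 u] holds. *)
Definition summable_from1 (R : realType) (u : nat -> R) : Prop :=
  cvgn (fun m => \sum_(1 <= k < m) u k).

Definition sum_from1 (R : realType) (u : nat -> R) : R :=
  limn (fun m => \sum_(1 <= k < m) u k).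

(* Main.v *)
Require Import Defs.
From HB Require Import structures.
From mathcomp Require Import all_boot all_order all_algebra.
From mathcomp Require Import all_classical all_reals all_analysis.
From mathcomp Require Import measurable_realfun.
From mathcomp Require Import ring lra.

Import Order.TTheory GRing.Theory Num.Theory.
Import numFieldNormedType.Exports.

(** Given the arrival process, the customers are independent of each other, and
    one who arrived at time [x] is still present at time [t] with probability
    [expR (- mu * (t - x))]; an initial customer is treated as one who arrived
    at time 0. Let [G] be the sum of these conditional probabilities over all
    customers and [H] the sum of their squares. Then the number in system has
    expectation that of [G], and second moment that of [G ^+ 2 + G - H], as
    only the diagonal terms of the double sum differ ([truncated_moments],
    [number_in_system_moments]).

    Up to the initial customers [G] and [H] are [n] times a shot noise, that is,
    the sum of a weight [g] over the arrival epochs. Campbell's formulas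
    ([campbell_moments]) give its mean, the integral of [f * g], and its
    variance, the integral of [f * g ^+ 2]; they are obtained by approximating
    the shot noise by combinations of independent Poisson increments. Hence,
    with [I1] and [I2] the integrals from 0 to [t] of [f x] against
    [expR (- mu * (t - x))] and [expR (- 2 * mu * (t - x))], the mean and the
    variance of the number in system are
    [q0 * p + n * I1] and
    [q0 * (p - p ^+ 2) + n * I1 + n * (n - 1) * I2] for [p = expR (- mu * t)].

    It remains to expand [I1] and [I2] in the Fourier coefficients of [f], which
    is merely integrable, so that its Fourier series may diverge
    ([fourier_conv_expR]). The partial sums to be studied are
    integrals over a period of [f] against translates of the partial sums of
    [\sum_k (m * cos (k * x) - k * sin (k * x)) / (k ^+ 2 + m ^+ 2)], the Fourier
    series of an exponential made periodic, with [m] equal to [mu] or [2 * mu].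
    The latter are uniformly bounded ([sawtooth_bounded]) and converge
    ([sawtooth_cvg_exp]), because an exponential factor turns their derivative
    into a Dirichlet kernel ([sawtooth_oscillation]). Dominated convergence then
    gives the sums in terms of an integral of [f] against an exponential over a
    full period, and its dependence on [t] is the integral from 0 to [t]
    ([itv_integral_expR_period]). *)

Set Implicit Arguments.
Unset Strict Implicit.
Unset Printing Implicit Defensive.

Local Open Scope classical_set_scope.
Local Open Scope ring_scope.

(** * The Fourier series of a periodic exponential *)

(** Up to a factor and the mean value, the Fourier series of the function of
    period [2 * pi] equal to [expR (m * x)] on the open interval from 0 to
    [2 * pi]. *)
Definition sawtooth_term (R : realType) (m x : R) (k : nat) : R :=
  (m * cos (k%:R * x) - k%:R * sin (k%:R * x)) / (k%:R ^+ 2 + m ^+ 2).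

Definition sawtooth (R : realType) (m : R) (N : nat) (x : R) : R :=
  \sum_(1 <= k < N) sawtooth_term m x k.

Lemma dirichlet_kernelE (R : realType) (N : nat) (x : R) : (0 < N)%N ->
  2 * sin (x / 2) * (2^-1 + \sum_(1 <= k < N) cos (k%:R * x)) =
  sin ((N%:R - 2^-1) * x).
Proof.
case: N => // N _; elim: N => [|N IH].
  rewrite big_geq// addr0 (_ : (1 - 2^-1) * x = x / 2); last by field.
  by field.
rewrite big_nat_recr//= addrA mulrDr IH.
rewrite (_ : (N.+1%:R - 2^-1) * x = N.+1%:R * x - x / 2); last by field.
rewrite (_ : (N.+2%:R - 2^-1) * x = N.+1%:R * x + x / 2); last first.
  by rewrite -natr1; field.
rewrite sinB sinD; ring.
Qed.

Lemma is_derive_sawtooth_term (R : realType) (m x : R) (k : nat) : m != 0 ->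
  is_derive x 1 (fun y => sawtooth_term m y k)
    (m * sawtooth_term m x k - cos (k%:R * x)).
Proof.
move=> m0; rewrite /sawtooth_term.
have k0 : k%:R ^+ 2 + m ^+ 2 != 0 :> R.
  by rewrite gt_eqF// ltr_wpDl ?sqr_ge0// exprn_even_gt0.
apply: is_derive_eq; rewrite /GRing.scale /=.
by field.
Qed.

(** Termwise the series solves [y' = m * y] up to a cosine, so the defect of
    the partial sum is a Dirichlet kernel without its constant term. *)
Lemma is_derive_sawtooth (R : realType) (m x : R) (N : nat) : m != 0 ->
  is_derive x 1 (sawtooth m N)
    (m * sawtooth m N x - \sum_(1 <= k < N) cos (k%:R * x)).
Proof.
move=> m0; elim: N => [|N IH].
  rewrite /sawtooth; under eq_fun do rewrite big_geq//.
  rewrite !big_geq// mulr0 subr0; exact: is_derive_cst.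
case: N IH => [|N] IH.
  rewrite /sawtooth; under eq_fun do rewrite big_geq//.
  rewrite !big_geq// mulr0 subr0; exact: is_derive_cst.
rewrite (_ : sawtooth m N.+2 =
    sawtooth m N.+1 \+ (fun y => sawtooth_term m y N.+1)); last first.
  by apply/funext => y; rewrite /sawtooth big_nat_recr.
have H := @is_derive_sawtooth_term R m x N.+1 m0.
apply: is_derive_eq; rewrite /sawtooth !(big_nat_recr N.+1)//=; ring.
Qed.

Lemma sin_ge_half (R : realType) (y : R) : 0 <= y <= pi / 2 -> y / 2 <= sin y.
Proof.
move=> /andP[y0 ypi].
have pi0 := pi_gt0 R.
have xcos (x : R) : 0 <= x <= pi / 2 -> x * cos x <= sin x.
  move=> /andP[x0 xpi].
  pose F (z : R) : R := sin z - z * cos z.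
  have dF (z : R) : is_derive z 1 F (z * sin z).
    by rewrite /F; apply: is_derive_eq; rewrite /GRing.scale /=; ring.
  have [c] : exists2 c, c \in `[0, x] & F x - F 0 = c * sin c * (x - 0).
    apply: (@MVT_segment R F (fun z => z * sin z)) => //.
    by apply: derivable_within_continuous => z _; have [] := dF z.
  rewrite in_itv/= => /andP[c0 cx].
  rewrite /F sin0 mul0r !subr0 => E.
  rewrite -subr_ge0 E !mulr_ge0//.
  by rewrite sin_ge0_pi// c0 (le_trans cx)// (le_trans xpi)//; lra.
(* Double the angle in [x * cos x <= sin x] at [y / 2]. *)
have := @cos_ge0_pihalf R y; rewrite ypi andbT => /(_ ltac:(lra)).
have := xcos (y / 2); rewrite divr_ge0//= => /(_ ltac:(lra)).
have : 0 <= cos (y / 2) by apply: cos_ge0_pihalf; apply/andP; split; lra.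
rewrite [in cos y](splitr y) [in sin y](splitr y) sinD cosD.
move: (cos2Dsin2 (y / 2)); set c := cos _; set s := sin _ => cs c0 ycs cs0.
have : (y / 2 * c) * c <= s * c by rewrite ler_wpM2r.
have : y * 2^-1 <= y * c ^+ 2 by rewrite ler_wpM2l//; lra.
by rewrite expr2; lra.
Qed.

(** Adding [C / x] to the function or to its opposite makes it nonincreasing.
    Integrating the bound on the derivative in this way loses only one power of
    [a], where the mean value theorem alone would lose two. *)
Lemma inverse_square_variation (R : realType) (f df : R -> R) (a b C : R) :
  0 < a -> a <= b ->
  (forall x, a <= x <= b -> is_derive x 1 f (df x)) ->
  (forall x, a <= x <= b -> `|df x| <= C / x ^+ 2) ->
  `|f b - f a| <= C / a.
Proof.
move=> a0 ab.
have half (g dg : R -> R) :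
    (forall x, a <= x <= b -> is_derive x 1 g (dg x)) ->
    (forall x, a <= x <= b -> `|dg x| <= C / x ^+ 2) -> g b - g a <= C / a.
  move=> Dg bg; pose G (x : R) : R := g x + C * x^-1.
  have C0 : 0 <= C.
    have := bg a; rewrite lexx ab => /(_ isT) /(le_trans (normr_ge0 _)).
    by rewrite pmulr_lge0// invr_gt0 exprn_gt0.
  have DG (x : R) : a <= x <= b -> is_derive x 1 G (dg x - C / x ^+ 2).
    move=> /[dup] /Dg dgx /andP[ax xb]; rewrite /G.
    have x0 : x != 0 by rewrite gt_eqF// (lt_le_trans a0).
    have := @is_deriveV R id x 1 1 x0 _ => H.
    by apply: is_derive_eq; rewrite /GRing.scale /= -exprVn; field.
  have [c] : exists2 c, c \in `[a, b] & G b - G a = (dg c - C / c ^+ 2) * (b - a).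
    apply: (@MVT_segment R G (fun x => dg x - C / x ^+ 2)) => // [z|].
      by rewrite in_itv/= => /andP[za zb]; apply: DG; rewrite !ltW.
    by apply: derivable_within_continuous => z; rewrite in_itv/= => /DG[].
  rewrite in_itv/= => cab GE.
  have : G b - G a <= 0.
    rewrite GE mulr_le0_ge0 ?subr_ge0// subr_le0.
    exact: le_trans (ler_norm _) (bg _ cab).
  have : 0 <= C * b^-1 by rewrite mulr_ge0// invr_ge0 ltW// (lt_le_trans a0).
  by rewrite /G; lra.
move=> Df bf; rewrite ler_norml; apply/andP; split; last exact: (half f df).
have : - f b - - f a <= C / a; last by lra.
apply: (half (\- f) (\- df)) => x /[dup] xab; [move=> /Df dfx|move=> /bf].
  exact: is_deriveN.
by rewrite /= normrN.
Qed.

Lemma normr_sin_le (R : realType) (x : R) : 0 <= x -> `|sin x| <= x.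
Proof.
move=> x0; have [c _] : exists2 c, c \in `[0, x] & sin x - sin 0 = cos c * (x - 0).
  apply: (@MVT_segment R (@sin R) (@cos R)) => //.
  by apply: continuous_subspaceT => z; exact: continuous_sin.
rewrite sin0 !subr0 => ->.
by rewrite normrM (ger0_norm x0) ler_piMl// cos_max.
Qed.

Lemma expR_le_normM (R : realType) (m x : R) :
  0 <= x <= pi -> expR (m * x) <= expR (`|m| * pi).
Proof.
move=> /andP[x0 xpi]; rewrite ler_expR (le_trans (ler_norm _))//.
by rewrite normrM (ger0_norm x0) ler_wpM2l.
Qed.

(** Multiplied by [expR (- m * x)], the partial sum shifted by [(2 * m)^-1] has
    derivative [- expR (- m * x)] times the Dirichlet kernel. One integration by
    parts of the oscillating sine gains the factor [N - 1/2], and what remains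
    is bounded by a multiple of [x ^- 2], since [sin (x / 2)] is at least
    [x / 4]. *)
Lemma sawtooth_oscillation (R : realType) (m : R) : m != 0 ->
  exists2 C : R, 0 <= C & forall N x, (0 < N)%N -> 0 < x <= pi ->
    `|expR (- m * x) * (sawtooth m N x + (2 * m)^-1)
      - expR (- m * pi) * (sawtooth m N pi + (2 * m)^-1)|
      <= C / (x * (N%:R - 2^-1)).
Proof.
move=> m0; have pi0 := pi_gt0 R.
pose E : R := expR (`|m| * pi); pose C : R := E * (2 * `|m| * pi + 4).
have E0 : 0 < E by exact: expR_gt0.
have C0 : 0 <= C by rewrite mulr_ge0 ?addr_ge0 ?mulr_ge0// ltW.
exists (C + 4 * E); first by rewrite addr_ge0// mulr_ge0// ltW.
move=> N x N0 /andP[x0 xpi].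
pose w : R := N%:R - 2^-1.
have w0 : 0 < w.
  have : 1 <= N%:R :> R by rewrite ler1n.
  by rewrite /w; lra.
pose h (y : R) : R := expR (- m * y) / (2 * sin (y / 2)).
pose dh (y : R) : R :=
  - m * h y - expR (- m * y) * cos (y / 2) / (4 * sin (y / 2) ^+ 2).
(* The boundary term of the integration by parts is included in [F]. *)
pose F (y : R) : R := expR (- m * y) * (sawtooth m N y + (2 * m)^-1)
                      - cos (w * y) * h y / w.
have sin_ge (y : R) : 0 < y -> y <= pi -> y / 4 <= sin (y / 2).
  move=> y0 ypi; have := @sin_ge_half R (y / 2).
  by rewrite divr_ge0 ?(ltW y0)//= => /(_ ltac:(lra)); lra.
have sin_gt (y : R) : 0 < y -> y <= pi -> 0 < sin (y / 2).
  by move=> y0 ypi; rewrite (lt_le_trans _ (sin_ge _ y0 ypi))// divr_gt0.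
have hle (y : R) : 0 < y -> y <= pi -> 0 <= h y <= E * 2 / y.
  move=> y0 ypi; have sy := sin_gt _ y0 ypi.
  rewrite /h divr_ge0 ?mulr_ge0 ?expR_ge0 ?(ltW sy)//=.
  rewrite -mulrA ler_pM ?expR_ge0 ?invr_ge0 ?mulr_ge0 ?(ltW sy)//.
    by rewrite mulNr -mulNr /E -(normrN m) expR_le_normM// ltW.
  rewrite (_ : 2 / y = (2 * (y / 4))^-1); last by field; rewrite gt_eqF.
  rewrite lef_pV2 ?posrE ?mulr_gt0//.
  by rewrite ler_wpM2l// sin_ge.
have dF (y : R) : x <= y <= pi -> is_derive y 1 F (- cos (w * y) * dh y / w).
  move=> /andP[xy ypi]; have y0 := lt_le_trans x0 xy.
  have sy : sin (y / 2) != 0 by rewrite gt_eqF// sin_gt.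
  have sy2 : 2 * sin (y / 2) != 0 by rewrite mulf_neq0.
  have H1 := @is_derive_sawtooth R m y N m0.
  have H2 := @is_deriveV R (fun y => 2 * sin (y / 2)) y 1 _ sy2 _.
  have := dirichlet_kernelE y N0.
  rewrite -/w => dk.
  have -> : - cos (w * y) * dh y / w = - cos (w * y) * dh y / w +
    expR (- m * y) * (sin (w * y) / (2 * sin (y / 2))
      - (2^-1 + \sum_(1 <= k < N) cos (k%:R * y))).
    by rewrite -dk; field; rewrite ?sy ?gt_eqF.
  rewrite /F /h; apply: is_derive_eq; rewrite /GRing.scale /= /dh /h.
  rewrite -exprVn; field.
  by rewrite sy m0 gt_eqF.
have dFle (y : R) : x <= y <= pi -> `|- cos (w * y) * dh y / w| <= C / w / y ^+ 2.
  move=> /andP[xy ypi]; have y0 := lt_le_trans x0 xy.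
  have /andP[h0 hl] := hle _ y0 ypi.
  have sy := sin_gt _ y0 ypi.
  rewrite normrM (ger0_norm (_ : 0 <= w^-1)) ?invr_ge0 ?(ltW w0)//.
  rewrite [leRHS]mulrAC ler_wpM2r ?invr_ge0 ?(ltW w0)//.
  rewrite normrM normrN.
  apply: (@le_trans _ _ `|dh y|); first by rewrite ler_piMl// cos_max.
  apply: (@le_trans _ _ (`|m| * (E * 2 / y) + E * 4 / y ^+ 2)).
    apply: (le_trans (ler_normB _ _)); apply: lerD.
      by rewrite normrM normrN (ger0_norm h0) ler_wpM2l.
    rewrite 2!normrM (ger0_norm (expR_ge0 _)) -mulrA -mulrA.
    apply: ler_pM; rewrite ?expR_ge0 ?mulr_ge0//.
      by rewrite mulNr -mulNr /E -(normrN m) expR_le_normM// ltW.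
    rewrite (ger0_norm (_ : 0 <= (4 * sin (y / 2) ^+ 2)^-1));
      last by rewrite invr_ge0 mulr_ge0 ?exprn_ge0 ?(ltW sy).
    apply: (@le_trans _ _ (1 * (4 * (y / 4) ^+ 2)^-1)).
      rewrite ler_pM ?cos_max ?invr_ge0 ?mulr_ge0 ?exprn_ge0 ?(ltW sy)//.
      rewrite lef_pV2 ?posrE ?mulr_gt0 ?exprn_gt0 ?divr_gt0//.
      rewrite ler_wpM2l// lerXn2r ?nnegrE ?divr_ge0 ?(ltW y0) ?(ltW sy)//.
      exact: sin_ge.
    by rewrite le_eqVlt; apply/orP; left; apply/eqP; field; rewrite gt_eqF.
  rewrite (_ : `|m| * (E * 2 / y) = E * (2 * `|m| * y) / y ^+ 2); last first.
    by field; rewrite gt_eqF.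
  rewrite -mulrDl -mulrDr ler_wpM2r ?invr_ge0 ?exprn_ge0 ?(ltW y0)//.
  by rewrite /C ler_wpM2l ?(ltW E0)// lerD2r ler_wpM2l ?mulr_ge0.
have := inverse_square_variation x0 xpi dF dFle.
have corr (y : R) : x <= y <= pi -> `|cos (w * y) * h y / w| <= E * 2 / x / w.
  move=> /andP[xy ypi]; have y0 := lt_le_trans x0 xy.
  have /andP[h0 hl] := hle _ y0 ypi.
  rewrite normrM (ger0_norm (_ : 0 <= w^-1)) ?invr_ge0 ?(ltW w0)//.
  rewrite ler_wpM2r ?invr_ge0 ?(ltW w0)// normrM (ger0_norm h0).
  apply: (@le_trans _ _ (h y)); first by rewrite ler_piMl// cos_max.
  apply: le_trans hl _.
  by rewrite ler_wpM2l ?mulr_ge0 ?(ltW E0)// lef_pV2 ?posrE.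
have := corr pi; have := corr x; rewrite !lexx !xpi => /(_ isT) + /(_ isT).
rewrite /F -/w (_ : (C + 4 * E) / (x * w) = C / w / x + 2 * (E * 2 / x / w));
  last by field; rewrite !gt_eqF.
set c := cos (w * x) * h x / w; set d := cos (w * pi) * h pi / w.
by rewrite !ler_norml => /andP[? ?] /andP[? ?] /andP[? ?]; apply/andP; split; lra.
Qed.

Lemma sum_inv_sqr_le (R : realType) (N : nat) :
  \sum_(1 <= k < N) (k%:R ^+ 2)^-1 <= 2 :> R.
Proof.
case: N => [|N]; first by rewrite big_geq.
case: N => [|N]; first by rewrite big_geq.
apply: (@le_trans _ _ (2 - N.+1%:R^-1)); last by rewrite gerBl invr_ge0.
elim: N => [|N IH]; first by rewrite big_nat1; lra.
rewrite big_nat_recr//= (le_trans (lerD IH (lexx _)))//.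
have N0 : 0 < N.+1%:R :> R by rewrite ltr0n.
rewrite -subr_ge0 -[N.+2%:R]natr1.
set n : R := N.+1%:R in N0 *.
rewrite (_ : _ - _ = (n * (n + 1) ^+ 2)^-1); last by field; apply/andP; split; lra.
by rewrite invr_ge0 mulr_ge0 ?exprn_ge0//; lra.
Qed.

Lemma normr_sawtooth_term_le (R : realType) (m x : R) (k : nat) : (0 < k)%N ->
  `|sawtooth_term m x k| <= `|m| * (k%:R ^+ 2)^-1 + `|sin (k%:R * x)| / k%:R.
Proof.
move=> k0; have k1 : 0 < k%:R :> R by rewrite ltr0n.
have d0 : 0 < k%:R ^+ 2 + m ^+ 2 by rewrite ltr_pwDl ?sqr_ge0// exprn_gt0.
rewrite /sawtooth_term normrM (ger0_norm (_ : 0 <= (k%:R ^+ 2 + m ^+ 2)^-1));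
  last by rewrite invr_ge0 ltW.
apply: (@le_trans _ _ ((`|m| + k%:R * `|sin (k%:R * x)|) / k%:R ^+ 2)).
  apply: ler_pM; rewrite ?invr_ge0 ?(ltW d0)//.
    apply: (le_trans (ler_normB _ _)); rewrite 2!normrM (ger0_norm (ltW k1)).
    by rewrite lerD2r ler_piMr// cos_max.
  by rewrite lef_pV2 ?posrE ?exprn_gt0// lerDl sqr_ge0.
by rewrite mulrDl lerD2l expr2 invfM mulrACA divff ?mul1r// gt_eqF.
Qed.

(** Reflecting the variable amounts to changing the sign of [m]; this is why
    [m] is allowed to be negative. *)
Lemma sawtoothN (R : realType) (m x : R) (N : nat) :
  sawtooth m N (2 * pi - x) = - sawtooth (- m) N x.
Proof.
rewrite /sawtooth -sumrN; apply: eq_bigr => k _; rewrite /sawtooth_term sqrrN.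
rewrite -[RHS]mulNr; congr (_ / _).
rewrite mulrBr (_ : k%:R * (2 * pi) = pi *+ 2 *+ k); last first.
  by rewrite mulr_natl mulr_natl.
have cosk (y : R) : cos (pi *+ 2 *+ k - y) = cos y.
  by rewrite addrC (periodicn (@cosD2pi R)) cosN.
have sink (y : R) : sin (pi *+ 2 *+ k - y) = - sin y.
  by rewrite addrC (periodicn (@sinD2pi R)) sinN.
by rewrite cosk sink; ring.
Qed.

Lemma sin_natr_pi (R : realType) (k : nat) : sin (k%:R * pi) = 0 :> R.
Proof.
by rewrite mulr_natl; elim: k => [|k IH]; rewrite ?mulr0n ?sin0// mulrS sinD IH sinpi
  mul0r mulr0 addr0.
Qed.

Lemma normr_sawtooth_pi (R : realType) (m : R) (N : nat) :
  `|sawtooth m N pi| <= 2 * `|m|.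
Proof.
apply: (le_trans (ler_norm_sum _ _ _)).
apply: (@le_trans _ _ (\sum_(1 <= k < N) `|m| * (k%:R ^+ 2)^-1)).
  rewrite big_nat_cond [leRHS]big_nat_cond; apply: ler_sum => k /andP[/andP[k0 _] _].
  by rewrite (le_trans (normr_sawtooth_term_le _ _ k0))// sin_natr_pi normr0 mul0r addr0.
by rewrite -mulr_sumr mulrC ler_wpM2r// sum_inv_sqr_le.
Qed.

(** For [x] below [1 / (N - 1/2)] the inequality [`|sin (k * x)| <= k * x]
    bounds the [N] terms one by one; above it the oscillation estimate is
    uniform and compares with the value at [pi], where the series converges
    absolutely. Reflection covers the second half of the period. *)
Lemma sawtooth_bounded (R : realType) (m : R) : m != 0 ->
  exists C : R, forall N x, 0 < x < 2 * pi -> `|sawtooth m N x| <= C.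
Proof.
move=> m0; have pi0 := pi_gt0 R.
have half (p : R) : p != 0 ->
    exists C : R, forall N x, 0 < x <= pi -> `|sawtooth p N x| <= C.
  move=> p0; have [C C0 osc] := sawtooth_oscillation p0.
  pose E : R := expR (`|p| * pi).
  pose B : R := E * (C + E * (2 * `|p| + `|(2 * p)^-1|)) + `|(2 * p)^-1|.
  exists (Num.max B (2 * `|p| + 2)) => N x /andP[x0 xpi].
  have [->|N0] := posnP N.
    rewrite /sawtooth big_geq// normr0 le_max; apply/orP; right.
    by rewrite addr_ge0// mulr_ge0.
  have N1 : 1 <= N%:R :> R by rewrite ler1n.
  have [xN|xN] := leP (x * (N%:R - 2^-1)) 1.
    rewrite le_max; apply/orP; right.
    apply: (le_trans (ler_norm_sum _ _ _)).
    apply: (@le_trans _ _ (\sum_(1 <= k < N) (`|p| * (k%:R ^+ 2)^-1 + x))).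
      rewrite big_nat_cond [leRHS]big_nat_cond.
      apply: ler_sum => k /andP[/andP[k0 _] _].
      rewrite (le_trans (normr_sawtooth_term_le _ _ k0))// lerD2l.
      have k1 : 0 < k%:R :> R by rewrite ltr0n.
      by rewrite ler_pdivrMr// mulrC normr_sin_le// mulr_ge0 ?ltW.
    rewrite big_split/= -mulr_sumr lerD//.
      by rewrite mulrC ler_wpM2r// sum_inv_sqr_le.
    rewrite sumr_const_nat -[x *+ _]mulr_natr natrB//.
    have := mulr_ge0 (ltW x0) (_ : 0 <= 2^-1 :> R); lra.
  rewrite le_max; apply/orP; left.
  have oscx : `|expR (- p * x) * (sawtooth p N x + (2 * p)^-1)|
      <= C + E * (2 * `|p| + `|(2 * p)^-1|).
    have {}osc : `|expR (- p * x) * (sawtooth p N x + (2 * p)^-1)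
      - expR (- p * pi) * (sawtooth p N pi + (2 * p)^-1)| <= C.
      rewrite (le_trans (osc N x N0 _)) ?x0//.
      by rewrite ler_pdivrMr ?(lt_trans ltr01)// ler_peMr// ltW.
    have : `|expR (- p * pi) * (sawtooth p N pi + (2 * p)^-1)|
        <= E * (2 * `|p| + `|(2 * p)^-1|).
      rewrite normrM ger0_norm ?expR_ge0//; apply: ler_pM => //.
      + by rewrite /E -(normrN p) expR_le_normM// lexx ltW.
      + by rewrite (le_trans (ler_normD _ _))// lerD2r normr_sawtooth_pi.
    move: osc; rewrite !ler_norml => /andP[? ?] /andP[? ?]; apply/andP; split; lra.
  have : `|sawtooth p N x + (2 * p)^-1| <= E * (C + E * (2 * `|p| + `|(2 * p)^-1|)).
    rewrite (_ : sawtooth p N x + _ = expR (p * x)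
      * (expR (- p * x) * (sawtooth p N x + (2 * p)^-1))); last first.
      by rewrite mulrA -expRD mulNr subrr expR0 mul1r.
    rewrite normrM.
    rewrite ger0_norm ?expR_ge0// ler_pM ?expR_ge0//.
    by rewrite expR_le_normM// xpi ltW.
  rewrite /B.
  have := lexx `|(2 * p)^-1|; rewrite {1}ler_norml => /andP[? ?].
  rewrite !ler_norml => /andP[? ?]; apply/andP; split; lra.
have [C1 H1] := half m m0.
have [C2 H2] := half (- m) (ltac:(by rewrite oppr_eq0)).
exists (Num.max C1 C2) => N x /andP[x0 x2pi].
have [xpi|xpi] := leP x pi; first by rewrite le_max H1// x0.
rewrite le_max -[x](subKr (2 * pi)) sawtoothN normrN H2 ?orbT//.
by apply/andP; split; lra.
Qed.

Lemma cvgn_sum_from1_normed (R : realType) (u : nat -> R) (M : R) :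
  (forall N, \sum_(1 <= k < N) `|u k| <= M) -> summable_from1 u.
Proof.
move=> uM; pose v k := if k == 0%N then 0 else u k.
have sumv (g : R -> R) N : g 0 = 0 ->
    \sum_(0 <= k < N) g (v k) = \sum_(1 <= k < N) g (u k).
  move=> g0; case: N => [|N]; first by rewrite !big_geq.
  rewrite big_ltn// g0 add0r big_nat_cond [RHS]big_nat_cond.
  by apply: eq_bigr => -[].
rewrite /summable_from1 (_ : (fun N => _) = series v); last first.
  by apply/funext => N; rewrite /series/= (sumv id).
apply: normed_cvg; apply: nondecreasing_is_cvgn.
  apply/nondecreasing_seqP => N.
  rewrite -[leLHS]/(\sum_(0 <= k < N) `|v k|) -[leRHS]/(\sum_(0 <= k < N.+1) `|v k|).
  by rewrite big_nat_recr//= lerDl.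
exists M => _ [N _ <-]; apply: le_trans (uM N).
by rewrite -(sumv (fun y => `|y|)) ?normr0.
Qed.

Lemma sawtooth_pi_cvg (R : realType) (m : R) :
  exists l : R, (fun N => sawtooth m N pi) @ \oo --> l.
Proof.
suff : cvgn (fun N => sawtooth m N pi) by move=> h; exists (limn (fun N => sawtooth m N pi)).
apply: (@cvgn_sum_from1_normed R (sawtooth_term m pi) (2 * `|m|)) => N.
apply: (@le_trans _ _ (\sum_(1 <= k < N) `|m| * (k%:R ^+ 2)^-1)).
  rewrite big_nat_cond [leRHS]big_nat_cond; apply: ler_sum => k /andP[/andP[k0 _] _].
  by rewrite (le_trans (normr_sawtooth_term_le _ _ k0))// sin_natr_pi normr0 mul0r addr0.
by rewrite -mulr_sumr mulrC ler_wpM2r// sum_inv_sqr_le.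
Qed.

Lemma sawtooth_cvg_half (R : realType) (m l x : R) : m != 0 -> 0 < x <= pi ->
  (fun N => sawtooth m N pi) @ \oo --> l ->
  (fun N => sawtooth m N x) @ \oo -->
    expR (- m * pi) * (l + (2 * m)^-1) * expR (m * x) - (2 * m)^-1.
Proof.
move=> m0 /[dup] x0pi /andP[x0 xpi] cl.
have [C C0 osc] := sawtooth_oscillation m0.
rewrite -(cvg_shiftS (fun N => sawtooth m N x)).
have -> : (fun N => sawtooth m N.+1 x) = (fun N => expR (m * x) *
    ((expR (- m * x) * (sawtooth m N.+1 x + (2 * m)^-1)
      - expR (- m * pi) * (sawtooth m N.+1 pi + (2 * m)^-1))
      + expR (- m * pi) * (sawtooth m N.+1 pi + (2 * m)^-1)) - (2 * m)^-1).
  apply/funext => N; rewrite subrK mulrA -expRD mulNr subrr expR0 mul1r; ring.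
rewrite [X in _ --> X - _]mulrC.
apply: cvgB; last exact: cvg_cst.
apply: cvgM; first exact: cvg_cst.
rewrite -[X in _ --> X]add0r.
apply: cvgD; last first.
  apply: cvgM; first exact: cvg_cst.
  apply: cvgD; last exact: cvg_cst.
  by rewrite (cvg_shiftS (fun N => sawtooth m N pi)).
apply/cvgr0Pnorm_le => e e0.
have : (2 * C / x) *: @harmonic R @ \oo --> (2 * C / x) *: (0 : R^o).
  by apply: cvgZr; exact: cvg_harmonic.
rewrite scaler0 => /cvgr0Pnorm_le /(_ _ e0).
apply: filterS => N; apply: le_trans.
rewrite (le_trans (osc N.+1 x _ x0pi))//.
have N1 : 1 <= N.+1%:R :> R by rewrite ler1n.
have -> : ((2 * C / x) *: @harmonic R) N = C / (x * (2^-1 * N.+1%:R)).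
  by rewrite /GRing.scale/= /GRing.scale/=; field; rewrite !gt_eqF// ltr0n.
rewrite ger0_norm; last by rewrite divr_ge0// !mulr_ge0// ltW.
rewrite ler_wpM2l// lef_pV2 ?posrE ?mulr_gt0//; last by lra.
by rewrite ler_pM2l//; lra.
Qed.

(** At [pi] the sine terms vanish and the series converges absolutely; the
    oscillation estimate carries the limit to the other points, multiplied by
    the exponential. The limit at [pi] changes sign with [m], so that the two
    halves of the period share the same constant. *)
Lemma sawtooth_cvg (R : realType) (m : R) : m != 0 ->
  exists A : R, forall x, 0 < x < 2 * pi ->
    (fun N => sawtooth m N x) @ \oo --> A * expR (m * x) - (2 * m)^-1.
Proof.
move=> m0; have pi0 := pi_gt0 R.
have [l cl] := sawtooth_pi_cvg m.
exists (expR (- m * pi) * (l + (2 * m)^-1)) => x /andP[x0 x2pi].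
have [xpi|xpi] := leP x pi; first by apply: sawtooth_cvg_half; rewrite ?x0.
have y0 : 0 < 2 * pi - x <= pi by apply/andP; split; lra.
have Nm0 : - m != 0 by rewrite oppr_eq0.
have cl' : (fun N => sawtooth (- m) N pi) @ \oo --> - l.
  rewrite (_ : (fun N => _) = (fun N => - sawtooth m N pi)); first exact: cvgN.
  apply/funext => N; rewrite -[in LHS](opprK (sawtooth _ _ _)) -sawtoothN.
  by congr (- sawtooth _ _ _); lra.
have := sawtooth_cvg_half Nm0 y0 cl' => /cvgN.
have -> : - (expR (- - m * pi) * (- l + (2 * - m)^-1) * expR (- m * (2 * pi - x))
      - (2 * - m)^-1)
    = expR (- m * pi) * (l + (2 * m)^-1) * expR (m * x) - (2 * m)^-1.
  rewrite (_ : - m * (2 * pi - x) = m * x + (- m * pi + - m * pi)); last by ring.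
  rewrite 2!expRD [- - m * pi]mulNr expRN.
  by field; rewrite m0 gt_eqF// expR_gt0.
apply: cvg_trans; apply: near_eq_cvg; near=> N.
by rewrite -[LHS]/(- sawtooth (- m) N (2 * pi - x)) -sawtoothN subKr.
Unshelve. all: by end_near. Qed.

(** * Integrals over bounded intervals and periodicity *)

(** Half-open intervals are used throughout because they are the ones over
    which the arrivals are counted, and because they concatenate. *)
Definition itv_integrable (R : realType) (g : R -> R) : Prop :=
  measurable_fun [set: R] g /\
  forall a b, lebesgue_measure.-integrable `]a, b] (EFin \o g).

Definition itv_integral (R : realType) (g : R -> R) (a b : R) : R :=
  \int[lebesgue_measure]_(x in `]a, b]) g x.

Lemma locally_itv_integrable (R : realType) (f : R -> R) :
  locally_integrable [set: R] f -> itv_integrable f.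
Proof.
move=> [mf _ fK]; split => // a b.
apply: (@integrableS _ _ _ lebesgue_measure `[a, b]%classic) => //; first exact: subset_itv_oc_cc.
apply/integrableP; split; first exact/measurable_EFinP/measurable_funTS.
by apply: fK => //; exact: segment_compact.
Qed.

Lemma itv_integrableM (R : realType) (f h : R -> R) :
  itv_integrable f -> continuous h -> itv_integrable (fun x => f x * h x).
Proof.
move=> [mf fi] ch; have mh := continuous_measurable_fun ch.
split; first exact: measurable_funM.
move=> a b; rewrite (_ : EFin \o _ = ((EFin \o f) \* (EFin \o h))%E); last first.
  by apply/funext => x /=; rewrite EFinM.
apply: integrableMl => //; first exact: measurable_funTS.
have /compact_bounded[M [Mr hM]] : compact (h @` `[a, b]).
  apply: continuous_compact; last exact: segment_compact.
  exact: continuous_subspaceT.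
exists M; split => // x Mx y yab; apply: hM => //.
by exists y => //; apply: subset_itv_oc_cc yab.
Qed.

Lemma itv_integrableZ (R : realType) (f : R -> R) (c : R) :
  itv_integrable f -> itv_integrable (fun x => c * f x).
Proof.
move=> fi; rewrite (_ : (fun x => _) = (fun x => f x * cst c x)).
  by apply: itv_integrableM => //; exact: cst_continuous.
by apply/funext => x; rewrite mulrC.
Qed.

Lemma itv_integrableD (R : realType) (f g : R -> R) :
  itv_integrable f -> itv_integrable g -> itv_integrable (fun x => f x + g x).
Proof.
move=> [mf fi] [mg gi]; split; first exact: measurable_funD.
move=> a b; rewrite (_ : EFin \o _ = ((EFin \o f) \+ (EFin \o g))%E) //.
exact: integrableD.
Qed.

Lemma itv_integrable_cst (R : realType) (c : R) : itv_integrable (cst c).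
Proof.
split => // a b; apply: (@integrableS _ _ _ lebesgue_measure `[a, b]%classic) => //.
  exact: subset_itv_oc_cc.
apply: continuous_compact_integrable; first exact: segment_compact.
by apply: continuous_subspaceT => x; exact: cst_continuous.
Qed.

Lemma itv_integrable_continuous (R : realType) (h : R -> R) :
  continuous h -> itv_integrable h.
Proof.
move=> ch; rewrite (_ : h = fun x => cst 1 x * h x); last first.
  by apply/funext => x; rewrite mul1r.
by apply: itv_integrableM => //; exact: itv_integrable_cst.
Qed.

Lemma itv_integralD (R : realType) (f g : R -> R) (a b : R) :
  itv_integrable f -> itv_integrable g ->
  itv_integral (fun x => f x + g x) a b = itv_integral f a b + itv_integral g a b.
Proof. by move=> [_ fi] [_ gi]; rewrite /itv_integral RintegralD. Qed.

Lemma itv_integralZ (R : realType) (f : R -> R) (c a b : R) :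
  itv_integrable f ->
  itv_integral (fun x => c * f x) a b = c * itv_integral f a b.
Proof. by move=> [_ fi]; rewrite /itv_integral RintegralZl. Qed.

Lemma itv_integral_cat (R : realType) (g : R -> R) (b a c : R) :
  itv_integrable g -> a <= b -> b <= c ->
  itv_integral g a c = itv_integral g a b + itv_integral g b c.
Proof.
move=> [_ gi] ab bc; rewrite /itv_integral -(@Rintegral_itvB _ g (BRight a) (BRight c) b) ?bnd_simp//.
by rewrite addrC subrK.
Qed.

Lemma itv_integral_FTC (R : realType) (F g : R -> R) (a b : R) : a <= b ->
  (forall x : R, is_derive x 1 F (g x)) -> continuous g ->
  itv_integral g a b = F b - F a.
Proof.
rewrite le_eqVlt => /predU1P[<- _ _|ab Fg cg].
  by rewrite /itv_integral set_itv_ge ?bnd_simp ?ltxx// Rintegral_set0 subrr.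
have gi := itv_integrable_continuous cg.
have cF : continuous F.
  move=> x; apply/differentiable_continuous/derivable1_diffP.
  by have [] := Fg x.
rewrite /itv_integral Rintegral_itv_obnd_cbnd; last by case: gi.
rewrite /Rintegral (@continuous_FTC2 _ g F)//.
- by apply: continuous_subspaceT => x; exact: cg.
- split=> [x _||]; first by have [] := Fg x.
  + by apply: cvg_at_right_filter; exact: cF.
  + by apply: cvg_at_left_filter; exact: cF.
- by move=> x _; rewrite derive1E; have [_ ->] := Fg x.
Qed.

(** Named in order to carry the structure of measurable function, from which
    the pushforward by a translation gets its structure of measure. *)
Definition translate (R : realType) (c : R) :
  measurableTypeR R -> measurableTypeR R := fun x => x + c.

Lemma measurable_translate (R : realType) (c : R) :
  measurable_fun [set: R] (translate c : R -> R).
Proof. by rewrite /translate; exact: measurable_funD. Qed.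

HB.instance Definition _ (R : realType) (c : R) :=
  isMeasurableFun.Build _ _ _ _ (@translate R c) (@measurable_translate R c).

Lemma lebesgue_measure_shift (R : realType) (c : R) (A : set R) : measurable A ->
  pushforward lebesgue_measure (translate c) A
  = lebesgue_measure A.
Proof.
move=> mA; apply/esym/lebesgue_measure_unique => //= _ [[a b]] _ <-.
rewrite /pushforward (_ : _ @^-1` _ = `]a - c, b - c]%classic); last first.
  by apply/seteqP; split => x /=; rewrite !in_itv/= /translate ltrBlDr lerBrDr.
rewrite !lebesgue_measure_itv/= !lte_fin ltrD2r.
by rewrite -!EFinB (_ : b - c - (a - c) = b - a)//; ring.
Qed.

Lemma preimage_shift_itv (R : realType) (a b c : R) :
  (@translate R c) @^-1` `]a + c, b + c]%classic = `]a, b]%classic.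
Proof. by apply/seteqP; split => x /=; rewrite !in_itv/= /translate ltrD2r lerD2r. Qed.

Lemma itv_integrable_shift (R : realType) (g : R -> R) (c : R) :
  itv_integrable g -> itv_integrable (fun x => g (x + c)).
Proof.
move=> [mg gi]; have mgc := measurableT_comp mg (@measurable_translate R c).
split=> // a b; apply/integrableP; split.
  exact/measurable_EFinP/measurable_funTS.
have /integrableP[_] := gi (a + c) (b + c).
rewrite (@eq_measure_integral _ _ _ _
  (pushforward lebesgue_measure (translate c))); last first.
  by move=> A mA _; exact/esym/lebesgue_measure_shift.
rewrite ge0_integral_pushforward//=.
  by rewrite preimage_shift_itv.
by apply: measurable_funTS; apply: measurableT_comp => //; exact: measurableT_comp.
Qed.

Lemma itv_integral_shift (R : realType) (g : R -> R) (a b c : R) :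
  itv_integrable g ->
  itv_integral (fun x => g (x + c)) a b = itv_integral g (a + c) (b + c).
Proof.
move=> gi; have [_ gci] := itv_integrable_shift c gi; case: gi => mg gi.
rewrite /itv_integral /Rintegral; congr fine.
rewrite [RHS](@eq_measure_integral _ _ _ _
  (pushforward lebesgue_measure (translate c))); last first.
  by move=> A mA _; exact/esym/lebesgue_measure_shift.
rewrite integral_pushforward//=.
- by rewrite preimage_shift_itv.
- exact/measurable_EFinP.
- by rewrite preimage_shift_itv.
Qed.

(** Split the integral from [a] to [b + T] at [b] and at [a + T]: the pieces
    from [a] to [b] and from [a + T] to [b + T] are equal. *)
Lemma itv_integral_period (R : realType) (g : R -> R) (T a b : R) : 0 <= T ->
  itv_integrable g -> periodic g T ->
  itv_integral g a (a + T) = itv_integral g b (b + T).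
Proof.
move=> T0 gi gT; wlog ab : a b / a <= b => [H|].
  by have [ab|/ltW ba] := leP a b; [exact: H|apply/esym/H].
have := itv_integral_cat gi ab (_ : b <= b + T); rewrite lerDl => /(_ T0).
rewrite (@itv_integral_cat _ g (a + T) a (b + T))// ?lerDl ?lerD2r// addrC.
rewrite -(itv_integral_shift _ _ _ gi).
rewrite (_ : (fun x => g (x + T)) = g); first exact: addrI.
by apply/funext => x; exact: gT.
Qed.

(** * Convolution of a Fourier series with an exponential *)

Lemma continuous_sawtooth (R : realType) (m : R) (N : nat) : m != 0 ->
  continuous (sawtooth m N).
Proof.
move=> m0 x; apply/differentiable_continuous/derivable1_diffP.
by have [] := is_derive_sawtooth x N m0.
Qed.

Lemma and3_last (P1 P2 P3 : Prop) : [/\ P1, P2 & P3] -> P3. Proof. by case. Qed.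

Lemma continuous_expRM (R : realType) (m : R) : continuous (fun x : R => expR (m * x)).
Proof.
move=> x; apply/differentiable_continuous/derivable1_diffP.
by have [] := is_derive1_comp (is_derive_expR (m * x)) (is_deriveZ m (is_derive_id x 1)).
Qed.

(** The partial sums converge boundedly inside the period, so that dominated
    convergence applies to any integrable [f]; the series of [f] itself need
    not converge. *)
Lemma cvg_itv_integral_sawtooth (R : realType) (m A : R) (f : R -> R) : m != 0 ->
  (forall x, 0 < x < 2 * pi ->
    (fun N => sawtooth m N x) @ \oo --> A * expR (m * x) - (2 * m)^-1) ->
  itv_integrable f ->
  (fun N => itv_integral (fun x => f x * sawtooth m N x) 0 (2 * pi)) @ \oo -->
  itv_integral (fun x => f x * (A * expR (m * x) - (2 * m)^-1)) 0 (2 * pi).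
Proof.
move=> m0 cA fi.
have [C bC] := sawtooth_bounded m0.
have fsi N := itv_integrableM fi (@continuous_sawtooth R m N m0).
have cK : continuous (fun x : R => A * expR (m * x) - (2 * m)^-1).
  move=> x; apply: cvgB; last exact: cvg_cst.
  by apply: cvgM; [exact: cvg_cst|exact: continuous_expRM].
have fKi := itv_integrableM fi cK.
have ioo (g : R -> R) : itv_integrable g ->
    lebesgue_measure.-integrable `]0, 2 * pi[ (EFin \o g).
  move=> [_ gi]; apply: (@integrableS _ _ _ lebesgue_measure `]0, 2 * pi]%classic) => //.
  by apply: subset_itvl; rewrite bnd_simp.
have Ioo (g : R -> R) : itv_integrable g -> itv_integral g 0 (2 * pi) =
    fine (\int[lebesgue_measure]_(x in `]0, (2 * pi)%R[) (g x)%:E).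
  by move=> gi; rewrite /itv_integral -Rintegral_itv_bndo_bndc//; exact: ioo.
rewrite Ioo//.
under eq_fun do rewrite Ioo//.
apply: fine_cvg; rewrite fineK; last by apply: integrable_fin_num => //; exact: ioo.
apply: (and3_last (@dominated_convergence _ _ _ lebesgue_measure `]0, 2 * pi[%classic
  (measurable_itv _)
  (fun N x => (f x * sawtooth m N x)%:E)
  (fun x => (f x * (A * expR (m * x) - (2 * m)^-1))%:E)
  (fun x => (`|f x| * C)%:E) _ _ _ _ _)).
- by move=> N; apply/measurable_EFinP/measurable_funTS; case: (fsi N).
- by apply/measurable_EFinP/measurable_funTS; case: fKi.
- apply: aeW => x /=; rewrite in_itv/= => x02.
  apply: cvg_EFin; first by apply: nearW.
  by apply: cvgM; [exact: cvg_cst|exact: cA].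
- have H : lebesgue_measure.-integrable `]0, 2 * pi[ (abse \o (EFin \o f)).
    by apply: integrable_abse; exact: ioo.
  by apply: (integrableZr _ C H).
- apply: aeW => x N /=; rewrite in_itv/= => x02.
  by rewrite lee_fin normrM ler_wpM2l// bC.
Qed.

Lemma continuous_sawtooth_term (R : realType) (m : R) (k : nat) : m != 0 ->
  continuous (fun x => sawtooth_term m x k).
Proof.
move=> m0 x; apply/differentiable_continuous/derivable1_diffP.
by have [] := is_derive_sawtooth_term x k m0.
Qed.

Lemma sawtooth_termD2pi (R : realType) (m x : R) (k : nat) :
  sawtooth_term m (x + 2 * pi) k = sawtooth_term m x k.
Proof.
rewrite /sawtooth_term mulrDr (_ : k%:R * (2 * pi) = pi *+ 2 *+ k).
  by rewrite (periodicn (@cosD2pi R)) (periodicn (@sinD2pi R)).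
by rewrite mulr_natl mulr_natl.
Qed.

Lemma itv_integral_sawtooth (R : realType) (m : R) (N : nat) : m != 0 ->
  itv_integral (sawtooth m N) 0 (2 * pi) = 0.
Proof.
move=> m0; have pi0 := pi_gt0 R.
have s0 : itv_integral (fun _ : R => 0) 0 (2 * pi) = 0.
  by rewrite /itv_integral Rintegral_cst// mul0r.
elim: N => [|N IH].
  by rewrite /sawtooth; under eq_fun do rewrite big_geq//.
case: N IH => [|N] IH.
  by rewrite /sawtooth; under eq_fun do rewrite big_geq//.
rewrite (_ : sawtooth m N.+2 =
    fun x => sawtooth m N.+1 x + sawtooth_term m x N.+1); last first.
  by apply/funext => y; rewrite /sawtooth big_nat_recr.
have ct := @continuous_sawtooth_term R m N.+1 m0.
rewrite itv_integralD ?IH ?add0r; [|exact/itv_integrable_continuous/continuous_sawtooth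
  |exact: itv_integrable_continuous].
set k : R := N.+1%:R; have k0 : k != 0 by rewrite pnatr_eq0.
have d0 : k ^+ 2 + m ^+ 2 != 0.
  by rewrite gt_eqF// ltr_wpDl ?sqr_ge0// exprn_even_gt0.
pose F (x : R) : R := (m * sin (k * x) / k + cos (k * x)) / (k ^+ 2 + m ^+ 2).
have dF (x : R) : is_derive x 1 F (sawtooth_term m x N.+1).
  rewrite /F /sawtooth_term -/k.
  clearbody k; apply: is_derive_eq; rewrite /GRing.scale /=; field.
  by rewrite d0 k0.
rewrite (itv_integral_FTC _ dF)//; last by rewrite mulr_ge0 ?ltW.
rewrite /F mulr0 sin0 cos0 (_ : k * (2 * pi) = 0 + pi *+ 2 *+ N.+1); last first.
  by rewrite /k mulr_natl mulr_natl add0r.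
by rewrite (periodicn (@cosD2pi R)) (periodicn (@sinD2pi R)) sin0 cos0 subrr.
Qed.

(** The partial sums have mean zero over a period, hence so has their bounded
    limit; this determines the constant. *)
Lemma sawtooth_cvg_exp (R : realType) (m : R) : 0 < m ->
  exists2 A : R, A * (expR (2 * pi * m) - 1) = pi & forall x, 0 < x < 2 * pi ->
    (fun N => sawtooth m N x) @ \oo --> A * expR (m * x) - (2 * m)^-1.
Proof.
move=> m_gt0; have m0 : m != 0 by rewrite gt_eqF.
have pi0 := pi_gt0 R.
have [A cA] := sawtooth_cvg m0; exists A => //.
have := cvg_itv_integral_sawtooth m0 cA (itv_integrable_cst 1).
rewrite /cst/=; under eq_fun do under eq_fun do rewrite mul1r.
under eq_fun do rewrite itv_integral_sawtooth//.
under [in X in _ --> X]eq_fun do rewrite mul1r.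
have dF (x : R) : is_derive x 1 (fun x => A * expR (m * x) / m - (2 * m)^-1 * x)
    (A * expR (m * x) - (2 * m)^-1).
  by apply: is_derive_eq; rewrite /GRing.scale /=; field.
rewrite (itv_integral_FTC _ dF); last first.
- move=> x; apply: cvgB; last exact: cvg_cst.
  by apply: cvgM; [exact: cvg_cst|exact: continuous_expRM].
- by rewrite mulr_ge0 ?ltW.
move=> /(cvg_lim (@Rhausdorff R)); rewrite lim_cst// => /esym.
rewrite mulr0 expR0 !mulr0 mulr1 subr0 => /eqP.
rewrite (_ : _ - _ = (A * (expR (2 * pi * m) - 1) - pi) / m); last first.
  by rewrite (mulrC m (2 * pi)); field.
by rewrite mulf_eq0 invr_eq0 (negbTE m0) orbF subr_eq0 => /eqP.
Qed.

Lemma itv_integral_period2pi (R : realType) (g : R -> R) (c : R) :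
  itv_integrable g -> periodic g (2 * pi) ->
  itv_integral g c (c + 2 * pi) = itv_integral g 0 (2 * pi).
Proof.
move=> gi gp; rewrite (itv_integral_period c 0 _ gi gp) ?add0r//.
by rewrite mulr_ge0// pi_ge0.
Qed.

(** This and the next definition are the Fourier coefficients of the periodic
    solution of [y' = - m * y + f], given those of [f]. *)
Definition conv_cos_coef (R : realType) (m : R) (a b : nat -> R) (k : nat) : R :=
  (a k * m - b k * k%:R) / (k%:R ^+ 2 + m ^+ 2).

Definition conv_sin_coef (R : realType) (m : R) (a b : nat -> R) (k : nat) : R :=
  (a k * k%:R + b k * m) / (k%:R ^+ 2 + m ^+ 2).

(** By the addition formulas, the coefficients of the convolution pair the
    Fourier coefficients of [f] with those of a translate of the exponential
    series; the translation is then moved to [f], by periodicity. *)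
Lemma conv_partial_sumE (R : realType) (m c l : R) (f : R -> R) (a b : nat -> R) N :
  m != 0 -> itv_integrable f -> periodic f (2 * pi) -> has_fourier_series f l a b ->
  \sum_(1 <= k < N) (conv_cos_coef m a b k * cos (k%:R * c)
                     + conv_sin_coef m a b k * sin (k%:R * c)) =
  pi^-1 * itv_integral (fun x => f (x + c) * sawtooth m N x) 0 (2 * pi).
Proof.
move=> m0 fi fp [_ aE bE]; have pi0 := pi_gt0 R.
have fci := itv_integrable_shift c fi.
elim: N => [|N IH].
  rewrite /sawtooth big_geq//; under eq_fun do rewrite big_geq// mulr0.
  by rewrite /itv_integral Rintegral_cst// mul0r mulr0.
case: N IH => [|N] IH.
  rewrite /sawtooth big_geq//; under eq_fun do rewrite big_geq// mulr0.
  by rewrite /itv_integral Rintegral_cst// mul0r mulr0.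
rewrite big_nat_recr//= IH.
rewrite (_ : (fun x => f (x + c) * sawtooth m N.+2 x) =
    fun x => f (x + c) * sawtooth m N.+1 x + f (x + c) * sawtooth_term m x N.+1); last first.
  by apply/funext => y; rewrite /sawtooth (big_nat_recr N.+1)//= mulrDr.
have ct := @continuous_sawtooth_term R m N.+1 m0.
rewrite itv_integralD; [|exact/itv_integrableM/continuous_sawtooth|exact: itv_integrableM].
rewrite [RHS]mulrDr; congr (_ + _).
set k : nat := N.+1; have k0 : (0 < k)%N by [].
pose g (x : R) : R := f x * sawtooth_term m (x - c) k.
have gi : itv_integrable g.
  apply: itv_integrableM => // x.
  apply: (@continuous_comp _ _ _ (fun x => x - c) (fun x => sawtooth_term m x k)).
    by apply: cvgB; [exact: cvg_id|exact: cvg_cst].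
  exact: ct.
have gp : periodic g (2 * pi).
  by move=> x; rewrite /g fp addrAC sawtooth_termD2pi.
rewrite (_ : (fun x => _) = fun x => g (x + c)); last first.
  by apply/funext => x; rewrite /g addrK.
rewrite itv_integral_shift// add0r [2 * pi + c]addrC itv_integral_period2pi//.
have ck : continuous (fun x : R => cos (k%:R * x)).
  move=> x; apply: (@continuous_comp _ _ _ (fun x : R => k%:R * x) (@cos R)).
    by apply: cvgM; [exact: cvg_cst|exact: cvg_id].
  exact: continuous_cos.
have sk : continuous (fun x : R => sin (k%:R * x)).
  move=> x; apply: (@continuous_comp _ _ _ (fun x : R => k%:R * x) (@sin R)).
    by apply: cvgM; [exact: cvg_cst|exact: cvg_id].
  exact: continuous_sin.
have fck := itv_integrableM fi ck; have fsk := itv_integrableM fi sk.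
have toitv (h : R -> R) : itv_integrable h ->
    \int[lebesgue_measure]_(x in `[0, 2 * pi]) h x = itv_integral h 0 (2 * pi).
  by move=> [_ hi]; rewrite /itv_integral Rintegral_itv_obnd_cbnd.
have d0 : k%:R ^+ 2 + m ^+ 2 != 0 :> R.
  by rewrite gt_eqF// ltr_wpDl ?sqr_ge0// exprn_even_gt0.
rewrite /conv_cos_coef /conv_sin_coef aE// bE// !toitv//.
rewrite (_ : g = fun x =>
  (m * cos (k%:R * c) + k%:R * sin (k%:R * c)) / (k%:R ^+ 2 + m ^+ 2)
    * (f x * cos (k%:R * x))
  + (m * sin (k%:R * c) - k%:R * cos (k%:R * c)) / (k%:R ^+ 2 + m ^+ 2)
    * (f x * sin (k%:R * x))); last first.
  apply/funext => x; rewrite /g /sawtooth_term mulrBr cosB sinB; field; exact: d0.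
rewrite itv_integralD; [|exact: itv_integrableZ..].
rewrite !itv_integralZ//.
move: (itv_integral _ _ _) (itv_integral _ _ _) pi^-1 => Ic Is z.
by field; exact: d0.
Qed.

(** Moving the window of integration by [t] replaces the interval from 0 to
    [t] by its translate by a period, on which [f] is the same and the
    exponential is larger by the factor [expR (2 * pi * m)]. *)
Lemma itv_integral_expR_period (R : realType) (m t : R) (f : R -> R) :
  0 <= t -> itv_integrable f -> periodic f (2 * pi) ->
  let W c := itv_integral (fun x => f (x + c) * expR (m * x)) 0 (2 * pi) in
  W t - expR (- m * t) * W 0 =
  (expR (2 * pi * m) - 1) * itv_integral (fun x => f x * expR (- m * (t - x))) 0 t.
Proof.
move=> t0 fi fp W; have pi0 := pi_gt0 R.
have t_le : t <= t + 2 * pi by lra.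
have pi2_ge0 : 0 <= 2 * pi :> R by lra.
have pi2_le : 2 * pi <= t + 2 * pi by lra.
pose g (x : R) : R := f x * expR (m * x).
have gi : itv_integrable g := itv_integrableM fi (@continuous_expRM R m).
have gc c : itv_integrable (fun x => g (x + c)) := itv_integrable_shift c gi.
have WE c : W c = expR (- m * c) * itv_integral g c (c + 2 * pi).
  have := itv_integral_shift 0 (2 * pi) c gi.
  rewrite add0r [2 * pi + c]addrC => <-; rewrite -(itv_integralZ _ _ _ (gc c)).
  congr itv_integral; apply/funext => x; rewrite /g mulrCA -expRD.
  by congr (_ * expR _); ring.
have IE : itv_integral (fun x => f x * expR (- m * (t - x))) 0 t
    = expR (- m * t) * itv_integral g 0 t.
  rewrite -(itv_integralZ _ _ _ gi); congr itv_integral; apply/funext => x.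
  by rewrite /g mulrCA -expRD; congr (_ * expR _); ring.
have per : itv_integral g (2 * pi) (t + 2 * pi)
    = expR (2 * pi * m) * itv_integral g 0 t.
  have := itv_integral_shift 0 t (2 * pi) gi; rewrite add0r => <-.
  rewrite -(itv_integralZ _ _ _ gi); congr itv_integral; apply/funext => x.
  by rewrite /g fp mulrCA -expRD; congr (_ * expR _); ring.
have := etrans (esym (itv_integral_cat gi t0 t_le)) (itv_integral_cat gi pi2_ge0 pi2_le).
rewrite per => cat.
rewrite !WE IE mulr0 expR0 mul1r add0r -mulrBr [RHS]mulrCA.
congr (_ * _).
move: (itv_integral g 0 t) (itv_integral g t _) (itv_integral g 0 (2 * pi)) cat.
by move=> a b c; lra.
Qed.

(** The sums of the combined series at [t], at [- t] and at 0 all converge, by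
    pairing translates of [f] with the exponential series. As cosine is even
    and sine is odd, these sums separate the two parts. *)
Lemma fourier_conv_expR (R : realType) (m t l : R) (f : R -> R) (a b : nat -> R) :
  0 < m -> 0 <= t -> itv_integrable f -> periodic f (2 * pi) ->
  has_fourier_series f l a b ->
  let C k := conv_cos_coef m a b k * (cos (k%:R * t) - expR (- m * t)) in
  let S k := conv_sin_coef m a b k * sin (k%:R * t) in
  [/\ summable_from1 C, summable_from1 S &
      itv_integral (fun x => f x * expR (- m * (t - x))) 0 t =
      l / m * (1 - expR (- m * t)) + sum_from1 C + sum_from1 S].
Proof.
move=> m_gt0 t0 fi fp ff C S; have m0 : m != 0 by rewrite gt_eqF.
have pi0 := pi_gt0 R.
have [A AE cA] := sawtooth_cvg_exp m_gt0.
pose T c N := \sum_(1 <= k < N) (conv_cos_coef m a b k * cos (k%:R * c)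
                               + conv_sin_coef m a b k * sin (k%:R * c)).
pose Phi c := pi^-1 *
  itv_integral (fun x => f (x + c) * (A * expR (m * x) - (2 * m)^-1)) 0 (2 * pi).
have cT c : T c @ \oo --> Phi c.
  rewrite (_ : T c = fun N => pi^-1 *
      itv_integral (fun x => f (x + c) * sawtooth m N x) 0 (2 * pi)); last first.
    by apply/funext => N; rewrite /T (conv_partial_sumE _ _ m0 fi fp ff).
  apply: cvgM; first exact: cvg_cst.
  by apply: cvg_itv_integral_sawtooth => //; exact: itv_integrable_shift.
have cS : (fun N => \sum_(1 <= k < N) S k) @ \oo --> (Phi t - Phi (- t)) / 2.
  rewrite (_ : (fun N => _) = fun N => (T t N - T (- t) N) / 2).
    by apply: cvgM; [exact: cvgB|exact: cvg_cst].
  apply/funext => N; rewrite /T -sumrB mulr_suml; apply: eq_bigr => k _.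
  by rewrite mulrN cosN sinN /S; field.
have cC : (fun N => \sum_(1 <= k < N) C k) @ \oo -->
    (Phi t + Phi (- t)) / 2 - Phi 0 * expR (- m * t).
  rewrite (_ : (fun N => _) =
      fun N => (T t N + T (- t) N) / 2 - T 0 N * expR (- m * t)).
    by apply: cvgB; (apply: cvgM; last exact: cvg_cst); [exact: cvgD|].
  apply/funext => N; rewrite /T -big_split/= mulr_suml mulr_suml -sumrB.
  apply: eq_bigr => k _.
  by rewrite mulrN cosN sinN mulr0 cos0 sin0 /C; field.
split; [by apply/cvg_ex; eexists; exact: cC|by apply/cvg_ex; eexists; exact: cS|].
rewrite /sum_from1 (cvg_lim _ cC)// (cvg_lim _ cS)//.
have fsi c := itv_integrable_shift c fi.
have feci c := itv_integrableM (fsi c) (@continuous_expRM R m).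
have PhiE c : Phi c = pi^-1 * (A *
    itv_integral (fun x => f (x + c) * expR (m * x)) 0 (2 * pi)) - l / m.
  rewrite /Phi (_ : (fun x => _) = (fun x => A * (f (x + c) * expR (m * x))
    + (- (2 * m)^-1) * f (x + c))); last by apply/funext => x; ring.
  rewrite itv_integralD; [|exact: itv_integrableZ..].
  rewrite !itv_integralZ// mulrDr; congr (_ + _).
  rewrite itv_integral_shift// add0r addrC itv_integral_period2pi//.
  case: ff => -> _ _; rewrite /itv_integral Rintegral_itv_obnd_cbnd; last by case: fi.
  have gen (I p : R) : p != 0 ->
      p^-1 * (- (2 * m)^-1 * I) = - ((2 * p)^-1 * I / m).
    by move=> p0; field; rewrite ?p0 ?m0.
  by apply: gen; rewrite gt_eqF.
have := itv_integral_expR_period m t0 fi fp; rewrite /= !PhiE.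
move: AE; set q := expR (2 * pi * m) - 1; set J := itv_integral _ 0 t.
set W0 := itv_integral (fun x => f (x + 0) * _) _ _.
set Wt := itv_integral (fun x => f (x + t) * _) _ _.
set Wn := itv_integral (fun x => f (x - t) * _) _ _.
set e := expR (- m * t) => AE WE.
have JE : J = pi^-1 * (A * (q * J)) by rewrite mulrA mulrA -mulrA AE mulKf ?gt_eqF.
by rewrite {1}JE -WE; lra.
Qed.

(** * Independence and product measures *)

(** Rectangles are stable under intersection and generate the product. *)
Lemma prod_measure_eq d1 d2 (T1 : measurableType d1) (T2 : measurableType d2)
    (R : realType) (m1 m2 : {measure set (T1 * T2) -> \bar R}) :
  (forall A B, measurable A -> measurable B -> m1 (A `*` B) = m2 (A `*` B)) ->
  (m1 setT < +oo)%E ->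
  forall X, measurable X -> m1 X = m2 X.
Proof.
move=> m12 m1oo X mX.
pose C : set (set (T1 * T2)) :=
  [set C | exists A, measurable A /\ exists B, measurable B /\ C = A `*` B].
apply: (measure_unique C (fun=> setT)) => //.
- rewrite measurable_prod_measurableType //; congr (<<s _ >>).
  rewrite predeqE; split => [[A mA [B mB <-]]|[A [mA [B [mB ->]]]]].
    by exists A; split => //; exists B.
  by exists A => //; exists B.
- move=> /= _ _ [X1 [mX1 [X2 [mX2 ->]]]] [Y1 [mY1 [Y2 [mY2 ->]]]].
  rewrite -setXI; exists (X1 `&` Y1); split; first exact: measurableI.
  by exists (X2 `&` Y2); split => //; exact: measurableI.
- by move=> n; exists setT; split => //; exists setT; split => //; rewrite setXTT.
- by rewrite bigcup_const.
- by move=> A [A1 [mA1 [A2 [mA2 ->]]]]; exact: m12.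
Qed.

Section independence.
Context d (T : measurableType d) (R : realType) (P : probability T R).

Lemma measurable_preimage d1 (U : measurableType d1) (X : T -> U) (B : set U) :
  measurable_fun setT X -> measurable B -> measurable (X @^-1` B).
Proof. by move=> mX mB; rewrite -[X in measurable X]setTI; exact: mX. Qed.

Lemma fubini_independent d1 d2 (U : measurableType d1) (V : measurableType d2)
    (X : T -> U) (Y : T -> V) (h : U * V -> \bar R) :
  measurable_fun setT X -> measurable_fun setT Y ->
  (forall B C, measurable B -> measurable C ->
    P (X @^-1` B `&` Y @^-1` C) = (P (X @^-1` B) * P (Y @^-1` C))%E) ->
  measurable_fun setT h -> (forall z, (0 <= h z)%E) ->
  (\int[P]_w h (X w, Y w) = \int[P]_w \int[P]_w' h (X w, Y w'))%E.
Proof.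
move=> mX mY ind mh h0.
pose X' : {mfun T >-> U} := HB.pack X (isMeasurableFun.Build _ _ _ _ X mX).
pose Y' : {mfun T >-> V} := HB.pack Y (isMeasurableFun.Build _ _ _ _ Y mY).
have mZ : measurable_fun setT (fun w => (X w, Y w)) by exact: measurable_fun_pair.
pose Z' : {mfun T >-> (U * V)%type} :=
  HB.pack (fun w => (X w, Y w)) (isMeasurableFun.Build _ _ _ _ _ mZ).
have E : forall K, measurable K ->
    (distribution P X' \x distribution P Y')%E K = distribution P Z' K.
  by apply: product_measure_unique => A B mA mB; exact: ind.
transitivity (\int[distribution P Z']_z h z)%E.
  by rewrite ge0_integral_distribution.
transitivity (\int[distribution P X' \x distribution P Y']_z h z)%E.
  by apply: eq_measure_integral => K mK _; exact/esym/E.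
rewrite fubini_tonelli1// ge0_integral_distribution//.
- apply: eq_integral => w _ /=; rewrite /fubini_F ge0_integral_distribution//.
  exact: measurableT_comp.
- exact: measurable_fun_fubini_tonelli_F.
- by move=> x; exact: integral_ge0.
Qed.

(** Both sides are finite measures of [K] that agree on rectangles. *)
Lemma independent_of_pair d1 d2 (U : measurableType d1) (V : measurableType d2)
    (X : T -> U) (Y : T -> V) (E : set T) :
  measurable_fun setT X -> measurable_fun setT Y -> measurable E ->
  (forall B C, measurable B -> measurable C ->
    P (E `&` (X @^-1` B `&` Y @^-1` C)) = (P E * P (X @^-1` B `&` Y @^-1` C))%E) ->
  forall K, measurable K ->
    P (E `&` (fun w => (X w, Y w)) @^-1` K) = (P E * P ((fun w => (X w, Y w)) @^-1` K))%E.
Proof.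
move=> mX mY mE ind K mK.
have mZ : measurable_fun setT (fun w => (X w, Y w)) by exact: measurable_fun_pair.
pose Z' : {mfun T >-> (U * V)%type} :=
  HB.pack (fun w => (X w, Y w)) (isMeasurableFun.Build _ _ _ _ _ mZ).
have PE0 : 0 <= fine (P E) by exact: fine_ge0.
pose m1 := mscale (NngNum PE0) (distribution P Z').
pose m2 := pushforward (mrestr P mE) Z'.
have H := @prod_measure_eq _ _ U V R m1 m2 _ _ K mK.
have PEE : (fine (P E))%:E = P E by rewrite fineK// fin_num_measure.
rewrite -PEE setIC; apply/esym/H.
- move=> A B mA mB; rewrite -[LHS]/((fine (P E))%:E * P (X @^-1` A `&` Y @^-1` B))%E.
  by rewrite -[RHS]/(P ((X @^-1` A `&` Y @^-1` B) `&` E)) PEE -ind// setIC.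
- rewrite -[ltLHS]/((fine (P E))%:E * P setT)%E probability_setT.
  by rewrite mule1 ltry.
Qed.

End independence.

Lemma exponential_prob_tail (R : realType) (mu y : R) : 0 < mu -> 0 <= y ->
  exponential_prob mu `]y, +oo[ = (expR (- mu * y))%:E.
Proof.
move=> mu0 y0; rewrite /exponential_prob integral_itv_obnd_cbnd; last first.
  apply/measurable_funTS/measurableT_comp => //; exact: measurable_exponential_pdf.
rewrite (_ : (\int[_]_(x in _) _)%E =
    (\int[lebesgue_measure]_(x in `[y, +oo[) (mu * expR (- mu * x))%:E)%E); last first.
  apply: eq_integral => x; rewrite inE/= in_itv/= andbT => yx.
  by rewrite exponential_pdfE// (le_trans y0).
have dE (x : R) : is_derive x 1 (fun x => - expR (- mu * x)) (mu * expR (- mu * x)).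
  by apply: is_derive_eq; rewrite /GRing.scale /=; ring.
have cE : continuous (fun x : R => expR (- mu * x)).
  move=> x; apply/differentiable_continuous/derivable1_diffP.
  have H := dE x; rewrite -[(fun x => _)]opprK.
  by apply: derivableN; have [] := H.
rewrite (@ge0_continuous_FTC2y _ _ (fun x => - (expR (- mu * x))) _ 0)//.
- by rewrite sub0e EFinN oppeK.
- by move=> x _; rewrite mulr_ge0 ?expR_ge0 ?ltW.
- apply: continuous_subspaceT => x.
  by apply: cvgM; [exact: cvg_cst|exact: cE].
- rewrite -oppr0; apply: cvgN.
  rewrite (_ : (fun x => expR (- mu * x)) =
               (fun z => expR (- z)) \o (fun z => mu * z)); last first.
    by apply: eq_fun => x; rewrite mulNr.
  apply: (@cvg_comp _ _ _ _ _ _ (pinfty_nbhs R)); last exact: cvgr_expR.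
  exact: gt0_cvgMry.
- by apply: cvg_at_right_filter; apply: cvgN; exact: cE.
- by move=> x _; rewrite derive1E; have [_ ->] := dE x.
Qed.

(** * Presence of a customer with a random arrival time *)

Section presence.
Context d (T : measurableType d) (R : realType) (P : probability T R).
Variables (mu t : R).
Hypothesis mu_gt0 : 0 < mu.

Definition present (x y : R) : bool := (x <= t) && (t < x + y).

(** For an arrival after [t] both values are 0, so that sums over arrivals need
    not be restricted to those before [t]. *)
Definition survival (x : R) : R := (x <= t)%R%:R * expR (- mu * (t - x)).

Lemma measurable_natr d1 (U : measurableType d1) (b : U -> bool) :
  measurable_fun setT b -> measurable_fun setT (fun x => (b x)%:R : R).
Proof.
by move=> mb; apply: (@measurableT_comp _ _ _ _ _ _ (fun c : bool => c%:R : R)).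
Qed.

Lemma measurable_present : measurable_fun setT (fun z : R * R => (present z.1 z.2)%:R : R).
Proof.
apply: measurable_natr; apply: measurable_and.
  exact: measurable_fun_ler.
apply: measurable_fun_ltr => //; exact: measurable_funD.
Qed.

Lemma measurable_survival : measurable_fun setT survival.
Proof.
apply: measurable_funM.
  by apply: measurable_natr; exact: measurable_fun_ler.
apply: measurableT_comp => //; apply: measurable_funM => //.
exact: measurable_funB.
Qed.

Lemma survival_ge0 x : 0 <= survival x.
Proof. by rewrite mulr_ge0// expR_ge0. Qed.

Lemma survival_le1 x : survival x <= 1.
Proof.
rewrite /survival; case: (leP x t) => xt; rewrite ?mul0r// mul1r -expR0 ler_expR.
by rewrite mulNr oppr_le0 mulr_ge0 ?subr_ge0// ltW.
Qed.

Lemma integral_bool (b : T -> bool) : measurable_fun setT b ->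
  (\int[P]_w (b w)%:R%:E = P [set w | b w])%E.
Proof.
move=> mb; have mB : measurable [set w | b w].
  rewrite (_ : [set w | b w] = b @^-1` [set true]); last by apply/seteqP; split => w.
  exact: measurable_preimage.
rewrite -[X in P X]setIT -(@integral_indic _ _ _ P setT)//.
by apply: eq_integral => w _; rewrite indicE mem_setE.
Qed.

Lemma exponential_survival (S : T -> R) (x : R) :
  (forall B, measurable B -> P (S @^-1` B) = exponential_prob mu B) ->
  x <= t -> P (S @^-1` `]t - x, +oo[) = (survival x)%:E.
Proof.
by move=> SE xt; rewrite /survival xt mul1r -exponential_prob_tail ?subr_ge0// -SE.
Qed.

(** Integrating first over the service time, for a fixed arrival time, leaves
    the tail of the exponential distribution. *)
Lemma presence_mean (a S : T -> R) :
  measurable_fun setT a -> measurable_fun setT S ->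
  (forall B, measurable B -> P (S @^-1` B) = exponential_prob mu B) ->
  (forall B C, measurable B -> measurable C ->
    P (a @^-1` B `&` S @^-1` C) = (P (a @^-1` B) * P (S @^-1` C))%E) ->
  \int[P]_w (present (a w) (S w))%:R = \int[P]_w survival (a w) :> R.
Proof.
move=> ma mS SE ind; congr fine.
rewrite (@fubini_independent _ _ _ P _ _ _ _ a S
  (fun z : R * R => (present z.1 z.2)%:R%:E))//; last first.
  by apply/measurable_EFinP; exact: measurable_present.
apply: eq_integral => w _ /=.
have [at_|ta] := boolP (a w <= t); last first.
  rewrite /present /survival (negbTE ta) mul0r.
  by under eq_integral do rewrite andFb; rewrite integral0.
rewrite -(exponential_survival SE at_) /present at_/= integral_bool; last first.
  by apply: measurable_fun_ltr => //; exact: measurable_funD.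
by congr (P _); apply/seteqP; split => w' /=; rewrite in_itv/= andbT ltrBlDl.
Qed.

(** The two arrival times may depend on each other, as they come from the same
    process; only the pair of service times is independent of them. *)
Lemma presence_mean2 (a b S U : T -> R) :
  measurable_fun setT a -> measurable_fun setT b ->
  measurable_fun setT S -> measurable_fun setT U ->
  (forall B, measurable B -> P (S @^-1` B) = exponential_prob mu B) ->
  (forall B, measurable B -> P (U @^-1` B) = exponential_prob mu B) ->
  (forall (B : set (R * R)) C D, measurable B -> measurable C -> measurable D ->
    P ((fun w => (a w, b w)) @^-1` B `&` (S @^-1` C `&` U @^-1` D)) =
    (P ((fun w => (a w, b w)) @^-1` B) * (P (S @^-1` C) * P (U @^-1` D)))%E) ->
  \int[P]_w ((present (a w) (S w))%:R * (present (b w) (U w))%:R) =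
  \int[P]_w (survival (a w) * survival (b w)) :> R.
Proof.
move=> ma mb mS mU SE UE ind; congr fine.
have mab : measurable_fun setT (fun w => (a w, b w)) by exact: measurable_fun_pair.
have mSU : measurable_fun setT (fun w => (S w, U w)) by exact: measurable_fun_pair.
have indSU C D : measurable C -> measurable D ->
    P (S @^-1` C `&` U @^-1` D) = (P (S @^-1` C) * P (U @^-1` D))%E.
  move=> mC mD; have := ind setT C D measurableT mC mD.
  by rewrite preimage_setT setTI probability_setT mul1e.
have mp (x y : (R * R) * (R * R) -> R) : measurable_fun setT x ->
    measurable_fun setT y -> measurable_fun setT (fun z => (present (x z) (y z))%:R : R).
  move=> mx my; rewrite (_ : (fun z => _) =
    (fun z : R * R => (present z.1 z.2)%:R : R) \o (fun z => (x z, y z)))//.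
  by apply: measurableT_comp; [exact: measurable_present|exact: measurable_fun_pair].
rewrite (@fubini_independent _ _ _ P _ _ _ _ (fun w => (a w, b w)) (fun w => (S w, U w))
  (fun z : (R * R) * (R * R) =>
    ((present z.1.1 z.2.1)%:R * (present z.1.2 z.2.2)%:R)%:E))//.
- apply: eq_integral => w _ /=.
  have [at_|ta] := boolP (a w <= t); last first.
    rewrite /present /survival (negbTE ta) !mul0r.
    by under eq_integral do rewrite andFb mul0r; rewrite integral0.
  have [bt|tb] := boolP (b w <= t); last first.
    rewrite /present /survival (negbTE tb) !(mul0r, mulr0).
    by under eq_integral do rewrite andFb mulr0; rewrite integral0.
  rewrite EFinM -(exponential_survival SE at_) -(exponential_survival UE bt) -indSU//.
  rewrite /present at_ bt/=.
  under eq_integral do rewrite -natrM mulnb.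
  rewrite integral_bool; last first.
    by apply: measurable_and; apply: measurable_fun_ltr => //; exact: measurable_funD.
  congr (P _); apply/seteqP; split => w' /=; rewrite !in_itv/= !andbT !ltrBlDl.
    by move=> /andP[].
  by move=> [-> ->].
- move=> B C mB mC; apply: independent_of_pair => //.
    by apply: measurable_preimage mB.
  by move=> C' D' mC' mD'; rewrite ind// indSU.
- apply/measurable_EFinP; apply: measurable_funM; apply: mp;
    exact: measurableT_comp.
Qed.

End presence.

(** * Moments of the Poisson distribution *)

(** The falling factorial cancels against [k`!] and shifts the exponential
    series by [j]. *)
Lemma poisson_ffact_series (R : realType) (m : R) (j : nat) :
  (fun n => \sum_(0 <= k < n) (k ^_ j)%:R * (m ^+ k / k`!%:R * expR (- m))) @ \oo
  --> m ^+ j.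
Proof.
rewrite -(cvg_shiftn j).
have : (fun n => m ^+ j * expR (- m) * series (exp_coeff m) n) @ \oo -->
    m ^+ j * expR (- m) * expR m.
  by apply: cvgM; [exact: cvg_cst|exact: is_cvg_series_exp_coeff].
rewrite (_ : m ^+ j * _ * _ = m ^+ j); last by rewrite -mulrA -expRD addNr expR0 mulr1.
apply: cvg_trans; rewrite (_ : (fun n => _) =
  fun n => m ^+ j * expR (- m) * series (exp_coeff m) n)//.
apply/funext => n; elim: n => [|n IH].
  have -> : series (exp_coeff m) 0%N = 0 by rewrite /series/= big_geq.
  rewrite add0n mulr0 big_nat_cond big1// => k /andP[/andP[_ kj] _].
  by rewrite ffact_small// mul0r.
rewrite addSn big_nat_recr//= IH seriesSr mulrDr; congr (_ + _).
rewrite /exp_coeff/= exprD -(ffact_fact (leq_addl n j)) addnK natrM.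
have nz k : k`!%:R != 0 :> R by rewrite pnatr_eq0 -lt0n fact_gt0.
have fz : ((n + j) ^_ j)%:R != 0 :> R by rewrite pnatr_eq0 -lt0n ffact_gt0 leq_addl.
by field; rewrite nz.
Qed.

Section counting.
Context d (T : measurableType d) (R : realType) (P : probability T R).

Lemma integral_nat_series (K : T -> nat) (g : nat -> R) :
  measurable_fun setT K -> (forall k, 0 <= g k) ->
  (\int[P]_w (g (K w))%:E = \sum_(0 <= k <oo) (g k)%:E * P [set w | K w = k])%E.
Proof.
move=> mK g0.
have mF k : measurable [set w | K w = k] by apply: (measurable_preimage (B := [set k]) mK).
have cover : \bigcup_k [set w | K w = k] = setT.
  by apply/seteqP; split => // w _; exists (K w).
rewrite -cover ge0_integral_bigcup//=.
- apply: eq_eseriesr => k _.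
  rewrite (eq_integral (cst (g k)%:E)); last by move=> w; rewrite inE/= => ->.
  by rewrite integral_cst.
- rewrite cover; apply/measurable_EFinP.
  exact: (@measurableT_comp _ _ _ _ _ _ g).
- by move=> w _; rewrite lee_fin.
- by move=> i j _ _ [w [/= <- <-]].
Qed.

Lemma poisson_ffact_moment (K : T -> nat) (m : R) (j : nat) : 0 <= m ->
  measurable_fun setT K ->
  (forall k, P [set w | K w = k] = (m ^+ k / k`!%:R * expR (- m))%:E) ->
  (\int[P]_w ((K w) ^_ j)%:R%:E = (m ^+ j)%:E)%E.
Proof.
move=> m0 mK KE; rewrite (@integral_nat_series K (fun k => (k ^_ j)%:R) mK)//.
under eq_eseriesr do rewrite KE -EFinM.
apply: cvg_lim => //.
under eq_fun do rewrite sumEFin.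
apply: cvg_EFin; first exact: nearW.
exact: poisson_ffact_series.
Qed.

Lemma ge0_integrable (X : T -> R) (e : R) : measurable_fun setT X ->
  (forall w, 0 <= X w) -> (\int[P]_w (X w)%:E = e%:E)%E ->
  P.-integrable setT (EFin \o X).
Proof.
move=> mX X0 XE; apply/integrableP; split; first exact/measurable_EFinP.
by under eq_integral do rewrite /= ger0_norm//; rewrite XE ltry.
Qed.

Lemma poisson_moments (K : T -> nat) (m : R) : 0 <= m ->
  measurable_fun setT K ->
  (forall k, P [set w | K w = k] = (m ^+ k / k`!%:R * expR (- m))%:E) ->
  [/\ P.-integrable setT (EFin \o (fun w => (K w)%:R)),
      P.-integrable setT (EFin \o (fun w => (K w)%:R ^+ 2)),
      \int[P]_w (K w)%:R = m & \int[P]_w ((K w)%:R ^+ 2) = m + m ^+ 2].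
Proof.
move=> m0 mK KE.
have mnat (g : nat -> R) : measurable_fun setT (fun w => g (K w)).
  exact: (@measurableT_comp _ _ _ _ _ _ g).
have E1 : (\int[P]_w (K w)%:R%:E = m%:E)%E.
  rewrite -[m in RHS]expr1 -(poisson_ffact_moment 1 m0 mK KE).
  by apply: eq_integral => w _; rewrite ffactn1.
have E2 : (\int[P]_w (K w * (K w).-1)%:R%:E = (m ^+ 2)%:E)%E.
  rewrite -(poisson_ffact_moment 2 m0 mK KE).
  by apply: eq_integral => w _; rewrite ffactnS ffactn1.
have i1 := ge0_integrable (mnat (fun k => k%:R)) (fun w => ler0n _ _) E1.
have i2 := ge0_integrable (mnat (fun k => (k * k.-1)%:R)) (fun w => ler0n _ _) E2.
have sq w : (K w)%:R ^+ 2 = (K w)%:R + (K w * (K w).-1)%:R :> R.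
  by rewrite -natrX -natrD; congr _%:R; case: (K w) => // k; rewrite -mulnn -mulnS.
split => //.
- rewrite (_ : EFin \o _ = ((EFin \o (fun w => (K w)%:R)) \+
    (EFin \o (fun w => (K w * (K w).-1)%:R)))%E); first exact: integrableD.
  by apply/funext => w /=; rewrite sq EFinD.
- by rewrite /Rintegral E1.
- under eq_Rintegral do rewrite sq.
  by rewrite RintegralD// /Rintegral E1 E2.
Qed.

End counting.

(** * Real-valued expectations *)

Lemma normr_limit_le (R : realType) (u : nat -> R) (l b : R) :
  u @ \oo --> l -> (forall n, `|u n| <= b) -> `|l| <= b.
Proof.
move=> ul ub; have h : (fun n => `|u n|) @ \oo --> `|l| by exact: cvg_norm.
rewrite -(cvg_lim _ h)//; apply: limr_le; first by apply/cvg_ex; eexists; exact: h.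
exact: nearW.
Qed.

Section expectations.
Context d (T : measurableType d) (R : realType) (P : probability T R).
Implicit Types X Y Z : T -> R.

Definition L1 X : Prop := P.-integrable setT (EFin \o X).

Definition mean X : R := \int[P]_w X w.

Lemma L1_measurable X : L1 X -> measurable_fun setT X.
Proof. by move=> /measurable_int /measurable_EFinP. Qed.

Lemma L1_le X Y : measurable_fun setT X -> (forall w, `|X w| <= Y w) -> L1 Y -> L1 X.
Proof.
move=> mX XY; apply: le_integrable => //; first exact/measurable_EFinP.
by move=> w _ /=; rewrite lee_fin (le_trans (XY w))// ler_norm.
Qed.

Lemma L1_cst (c : R) : L1 (cst c).
Proof. by apply: finite_measure_integrable_cst. Qed.

Lemma L1D X Y : L1 X -> L1 Y -> L1 (fun w => X w + Y w).
Proof. by move=> iX iY; exact: (integrableD measurableT iX iY). Qed.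

Lemma L1Z (c : R) X : L1 X -> L1 (fun w => c * X w).
Proof. by move=> iX; exact: (integrableZl measurableT c iX). Qed.

Lemma L1_sum (I : Type) (s : seq I) (F : I -> T -> R) : (forall i, L1 (F i)) ->
  L1 (fun w => \sum_(i <- s) F i w).
Proof.
move=> iF; elim: s => [|i s IH].
  by under [fun w => _]eq_fun do rewrite big_nil; exact: L1_cst.
under [fun w => _]eq_fun do rewrite big_cons; exact: L1D.
Qed.

Lemma mean_cst (c : R) : mean (cst c) = c.
Proof.
by rewrite /mean Rintegral_cst// [X in fine X](probability_setT P) mulr1.
Qed.

Lemma meanD X Y : L1 X -> L1 Y -> mean (fun w => X w + Y w) = mean X + mean Y.
Proof. by move=> iX iY; rewrite /mean RintegralD. Qed.

Lemma meanZ (c : R) X : L1 X -> mean (fun w => c * X w) = c * mean X.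
Proof. by move=> iX; rewrite /mean RintegralZl. Qed.

Lemma mean_sum (I : Type) (s : seq I) (F : I -> T -> R) : (forall i, L1 (F i)) ->
  mean (fun w => \sum_(i <- s) F i w) = \sum_(i <- s) mean (F i).
Proof.
move=> iF; elim: s => [|i s IH].
  by rewrite big_nil; under [fun w => _]eq_fun do rewrite big_nil; exact: mean_cst.
under [fun w => _]eq_fun do rewrite big_cons.
by rewrite big_cons meanD ?IH//; exact: L1_sum.
Qed.

Lemma mean_le X Y : L1 X -> L1 Y -> (forall w, X w <= Y w) -> mean X <= mean Y.
Proof. by move=> iX iY XY; apply: le_Rintegral. Qed.

Lemma mean_dist X Y Z : L1 X -> L1 Y -> L1 Z -> (forall w, `|X w - Y w| <= Z w) ->
  `|mean X - mean Y| <= mean Z.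
Proof.
move=> iX iY iZ XYZ.
have le1 : mean X <= mean Y + mean Z.
  rewrite -meanD//; apply: mean_le => //; first exact: L1D.
  by move=> w; have := XYZ w; rewrite ler_distl => /andP[]; lra.
have le2 : mean Y <= mean X + mean Z.
  rewrite -meanD//; apply: mean_le => //; first exact: L1D.
  by move=> w; have := XYZ w; rewrite ler_distl => /andP[]; lra.
by rewrite ler_distl; apply/andP; split; lra.
Qed.

Lemma normr_mean_le X Y : L1 X -> L1 Y -> (forall w, `|X w| <= Y w) ->
  `|mean X| <= mean Y.
Proof.
move=> iX iY XY; rewrite -[mean X]subr0 -(mean_cst 0).
by apply: mean_dist => // [|w]; [exact: L1_cst|rewrite subr0].
Qed.

Lemma mean_dominated (X_ : nat -> T -> R) X Y :
  (forall n, measurable_fun setT (X_ n)) -> measurable_fun setT X ->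
  (forall w, X_ ^~ w @ \oo --> X w) -> L1 Y -> (forall n w, `|X_ n w| <= Y w) ->
  (fun n => mean (X_ n)) @ \oo --> mean X.
Proof.
move=> mX_ mX cX iY XY.
have iX : L1 X.
  apply: L1_le iY => // w.
  exact: normr_limit_le (cX w) _.
apply: fine_cvg; rewrite fineK; last exact: integrable_fin_num.
apply: (and3_last (@dominated_convergence _ _ _ P setT measurableT
  (fun n w => (X_ n w)%:E) (fun w => (X w)%:E) (fun w => (Y w)%:E) _ _ _ _ _)).
- by move=> n; exact/measurable_EFinP.
- exact/measurable_EFinP.
- by apply: aeW => w _; apply: cvg_EFin; [exact: nearW|exact: cX].
- exact: iY.
- by apply: aeW => w n _; rewrite lee_fin.
Qed.

End expectations.

(** * Increments of the Poisson process *)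

(** On each step of the partition [g] differs by at most [eps] from the value
    that the sum uses. *)
Lemma riemann_sum_error (R : realType) (f g : R -> R) (u : nat -> R) (n : nat) (eps : R) :
  itv_integrable f -> (forall x, 0 <= f x) -> itv_integrable (fun x => f x * g x) ->
  {homo u : i j / (i <= j)%N >-> i <= j} ->
  (forall i x, (i < n)%N -> u i < x -> x <= u i.+1 -> `|g x - g (u i)| <= eps) ->
  `|itv_integral (fun x => f x * g x) (u 0%N) (u n)
    - \sum_(0 <= i < n) g (u i) * itv_integral f (u i) (u i.+1)|
  <= eps * itv_integral f (u 0%N) (u n).
Proof.
move=> fi f0 fgi hu; elim: n => [_|n IH gu].
  by rewrite big_geq// /itv_integral set_itv_ge ?bnd_simp ?ltxx// !Rintegral_set0 subr0
    normr0 mulr0.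
rewrite big_nat_recr//= (@itv_integral_cat _ f (u n) (u 0%N)) ?hu//.
rewrite (@itv_integral_cat _ (fun x => f x * g x) (u n) (u 0%N)) ?hu//.
rewrite opprD addrACA mulrDr (le_trans (ler_normD _ _))// lerD//.
  by apply: IH => i x ni; apply: gu; rewrite ltnS ltnW.
have fci := itv_integrableZ (g (u n)) fi.
have fei := itv_integrableZ eps fi.
have dE : itv_integral (fun x => f x * g x) (u n) (u n.+1)
    - g (u n) * itv_integral f (u n) (u n.+1)
    = itv_integral (fun x => f x * g x - g (u n) * f x) (u n) (u n.+1).
  rewrite -itv_integralZ// /itv_integral RintegralB//; [by case: fgi|by case: fci].
have di : itv_integrable (fun x => f x * g x - g (u n) * f x).
  rewrite (_ : (fun x => _) = (fun x => f x * g x + (- g (u n)) * f x)).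
    by apply: itv_integrableD => //; exact: itv_integrableZ.
  by apply/funext => x; rewrite mulNr.
rewrite dE -itv_integralZ// /itv_integral.
apply: (le_trans (le_normr_Rintegral _ _)) => //; first by case: di.
apply: le_Rintegral => //.
- by apply: integrable_norm; case: di.
- by case: fei.
- move=> x /=; rewrite in_itv/= => /andP[ux xu].
  rewrite (mulrC (f x)) -mulrBl normrM (ger0_norm (f0 x)) ler_wpM2r//.
  exact: gu.
Qed.

Lemma eq_of_le_harmonic (R : realType) (x y C : R) :
  (forall n, `|x - y| <= C / n.+1%:R) -> x = y.
Proof.
move=> xyC; apply/eqP; rewrite -subr_eq0 -normr_le0.
have cC : (fun n => C * n.+1%:R^-1) @ \oo --> C * 0.
  by apply: cvgM; [exact: cvg_cst|exact: cvg_harmonic].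
rewrite mulr0 in cC; rewrite -(cvg_lim _ cC)//; apply: limr_ge.
  by apply/cvg_ex; eexists; exact: cC.
by apply: nearW => n; exact: xyC.
Qed.

Section poisson_process.
Context d (T : measurableType d) (R : realType) (P : probability T R).
Variables (f : R -> R) (A : nat -> T -> R) (N : R -> T -> nat).
Hypothesis f0 : forall x, 0 <= f x.
Hypothesis arr : poisson_arrivals P f A N.

Let N0 w : N 0 w = 0%N. Proof. by case: arr. Qed.

Let AN t j w : 0 <= t -> (A j w <= t) = (j < N t w)%N.
Proof. by case: arr => _ H _ _; exact: H. Qed.

Lemma count_le s t w : 0 <= s -> s <= t -> (N s w <= N t w)%N.
Proof.
move=> s0 st; rewrite leqNgt; apply/negP => h.
have := AN (N t w) w s0; rewrite h => As.
have := AN (N t w) w (le_trans s0 st).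
by rewrite ltnn (le_trans As st).
Qed.

Lemma arrival_gt0 j w : 0 < A j w.
Proof. by rewrite ltNge AN// N0. Qed.

Definition increment (u : nat -> R) (i : nat) (w : T) : nat :=
  (N (u i.+1) w - N (u i) w)%N.

Lemma measurable_increment u i : 0 <= u 0%N -> {homo u : i j / (i <= j)%N >-> i <= j} ->
  measurable_fun setT (increment u i).
Proof.
move=> u0 hu; case: arr => _ _ _ /(_ u u0 hu) [+ _] => /(_ i) mi _ B mB.
by apply: mi; exists B.
Qed.

Lemma itv_integral_ge0 a b : 0 <= itv_integral f a b.
Proof. by apply: Rintegral_ge0. Qed.

Lemma increment_moments u i : 0 <= u 0%N -> {homo u : i j / (i <= j)%N >-> i <= j} ->
  [/\ L1 P (fun w => (increment u i w)%:R), L1 P (fun w => (increment u i w)%:R ^+ 2),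
      mean P (fun w => (increment u i w)%:R) = itv_integral f (u i) (u i.+1) &
      mean P (fun w => (increment u i w)%:R ^+ 2) =
        itv_integral f (u i) (u i.+1) + itv_integral f (u i) (u i.+1) ^+ 2].
Proof.
move=> u0 hu; apply: poisson_moments.
- exact: itv_integral_ge0.
- exact: measurable_increment.
- move=> k; case: arr => _ _ /(_ (u i) (u i.+1) k) + _; apply.
    by rewrite (le_trans u0)// hu.
  by rewrite hu.
Qed.

(** Fubini for the joint law of two increments, which is a product. *)
Lemma increment_cross_moment u i j : 0 <= u 0%N ->
  {homo u : i j / (i <= j)%N >-> i <= j} -> i != j ->
  mean P (fun w => (increment u i w)%:R * (increment u j w)%:R) =
  itv_integral f (u i) (u i.+1) * itv_integral f (u j) (u j.+1).
Proof.
move=> u0 hu ij.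
have mi := measurable_increment i u0 hu; have mj := measurable_increment j u0 hu.
have [i1 _ <- _] := increment_moments i u0 hu.
have [j1 _ <- _] := increment_moments j u0 hu.
have ind B C : measurable B -> measurable C ->
    P (increment u i @^-1` B `&` increment u j @^-1` C) =
    (P (increment u i @^-1` B) * P (increment u j @^-1` C))%E.
  move=> mB mC; case: arr => _ _ _ /(_ u u0 hu) [_ ind].
  pose E k := if k == i then increment u i @^-1` B else increment u j @^-1` C.
  have := ind [:: i; j] E; rewrite /= inE ij => /(_ isT).
  rewrite big_cons big_seq1 /E eqxx eq_sym (negbTE ij) EFinM.
  have mB' := measurable_preimage mi mB; have mC' := measurable_preimage mj mC.
  rewrite !fineK ?fin_num_measure//.
  move=> <-.
    congr (P _); apply/seteqP; split => w /=.
      by move=> [iB jC] k /=; rewrite !inE => /orP[/eqP ->|/eqP ->];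
        rewrite ?eqxx// eq_sym (negbTE ij).
    move=> H; have := H i; have := H j; rewrite /= !inE eqxx orbT/= eqxx.
    by rewrite eq_sym (negbTE ij) => /(_ isT) ? /(_ isT).
  move=> k; rewrite !inE => /orP[/eqP ->|/eqP ->].
    by rewrite eqxx; exists B => //; rewrite setTI.
  by rewrite eq_sym (negbTE ij); exists C => //; rewrite setTI.
rewrite /mean {1}/Rintegral.
rewrite (@fubini_independent _ _ _ P _ _ _ _ _ _
  (fun z : nat * nat => (z.1%:R * z.2%:R)%:E) mi mj ind)//.
- transitivity (fine (\int[P]_w ((increment u i w)%:R *
     (\int[P]_w' (increment u j w')%:R))%:E)%E).
    congr fine; apply: eq_integral => w _ /=.
    rewrite EFinM /Rintegral fineK ?integrable_fin_num//.
    rewrite -integralZl//.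
  by rewrite -RintegralZr.
- apply/measurable_EFinP; apply: measurable_funM.
    exact: (@measurableT_comp _ _ _ _ _ _ (fun k : nat => k%:R : R)).
  exact: (@measurableT_comp _ _ _ _ _ _ (fun k : nat => k%:R : R)).
Qed.

End poisson_process.

(** * Campbell's formulas for the first two moments *)

Lemma sum_natr_ltn (R : realType) (K M : nat) : (K <= M)%N ->
  \sum_(0 <= j < M) (j < K)%N%:R = K%:R :> R.
Proof.
move=> KM; rewrite (big_cat_nat (leq0n K) KM)/=.
rewrite (big_nat_cond _ _ K M) [X in _ + X]big1 ?addr0; last first.
  by move=> j /andP[/andP[Kj _] _]; rewrite ltnNge Kj.
rewrite big_nat_cond (eq_bigr (fun=> 1)); last by move=> j /andP[/andP[_ ->] _].
by rewrite -big_nat_cond sumr_const_nat subn0.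
Qed.

Lemma measurable_natr_comp d (T : measurableType d) (R : realType) (K : T -> nat) :
  measurable_fun setT K -> measurable_fun setT (fun w => (K w)%:R : R).
Proof. by move=> mK; exact: (@measurableT_comp _ _ _ _ _ _ (fun k : nat => k%:R : R)). Qed.

Lemma cvg_random_sum (R : realType) (F : nat -> R) (K : nat) :
  (fun J => \sum_(0 <= j < J) (j < K)%N%:R * F j) @ \oo --> \sum_(0 <= j < K) F j.
Proof.
apply: cvg_near_cst; exists K => // J /= KJ.
rewrite (big_cat_nat (leq0n K) KJ)/=.
rewrite (big_nat_cond _ _ K J) [X in _ + X]big1 ?addr0; last first.
  by move=> j /andP[/andP[Kj _] _]; rewrite ltnNge Kj mul0r.
rewrite big_nat_cond [RHS]big_nat_cond; apply: eq_bigr => j /andP[/andP[_ ->] _].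
by rewrite mul1r.
Qed.

Lemma measurable_random_sum d (T : measurableType d) (R : realType) (K : T -> nat)
    (F : nat -> T -> R) :
  measurable_fun setT K -> (forall j, measurable_fun setT (F j)) ->
  measurable_fun setT (fun w => \sum_(0 <= j < K w) F j w).
Proof.
move=> mK mF.
apply: (@measurable_fun_cvg _ _ _ setT
  (fun J w => \sum_(0 <= j < J) (j < K w)%N%:R * F j w)) => //.
- move=> J; apply: measurable_sum => j; apply: measurable_funM => //.
  exact: (@measurableT_comp _ _ _ _ _ _ (fun k : nat => (j < k)%N%:R : R)).
- by move=> w _; exact: cvg_random_sum.
Qed.

Lemma normr_sum_le_nat (R : realType) (F : nat -> R) (K : nat) (M : R) :
  (forall j, (j < K)%N -> `|F j| <= M) -> `|\sum_(0 <= j < K) F j| <= M * K%:R.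
Proof.
move=> FM; apply: (le_trans (ler_norm_sum _ _ _)).
rewrite mulr_natr -[K in M *+ K]subn0 -sumr_const_nat.
rewrite big_nat_cond [leRHS]big_nat_cond.
by apply: ler_sum => j /andP[/andP[_ jK] _]; exact: FM.
Qed.

Section campbell.
Context d (T : measurableType d) (R : realType) (P : probability T R).
Variables (f : R -> R) (A : nat -> T -> R) (N : R -> T -> nat).
Hypothesis fi : itv_integrable f.
Hypothesis f0 : forall x, 0 <= f x.
Hypothesis arr : poisson_arrivals P f A N.
Hypothesis mA : forall j, measurable_fun setT (A j).
Variables (t : R) (g : R -> R) (L M : R).
Hypothesis t0 : 0 <= t.
Hypothesis cg : continuous g.
Hypothesis L0 : 0 <= L.
Hypothesis gM : forall x, 0 <= x <= t -> `|g x| <= M.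
Hypothesis gL : forall x y, 0 <= x -> x <= y -> y <= t -> `|g y - g x| <= L * (y - x).

Let N0 w : N 0 w = 0%N. Proof. by case: arr. Qed.

Let AN s j w : 0 <= s -> (A j w <= s) = (j < N s w)%N.
Proof. by case: arr => _ H _ _; exact: H. Qed.

Let M0 : 0 <= M.
Proof. by apply: le_trans (gM (x := 0) _); rewrite ?lexx. Qed.

Definition shot_noise (w : T) : R := \sum_(0 <= j < N t w) g (A j w).

Let step (n i : nat) : R := i%:R * (t / n.+1%:R).

Let shot_step (n : nat) (w : T) : R :=
  \sum_(0 <= i < n.+1) g (step n i) * (increment N (step n) i w)%:R.

Let step0 n : step n 0 = 0. Proof. by rewrite /step mul0r. Qed.

Let stepn n : step n n.+1 = t.
Proof. by rewrite /step mulrC divfK// pnatr_eq0. Qed.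

Let h0 n : 0 <= t / n.+1%:R :> R. Proof. exact: divr_ge0. Qed.

Let hstep n : {homo step n : i j / (i <= j)%N >-> i <= j}.
Proof. by move=> i j ij; rewrite /step ler_wpM2r// ler_nat. Qed.

Let step_ge0 n i : 0 <= step n i. Proof. by rewrite -(step0 n) hstep. Qed.

Let step_le n i : (i <= n.+1)%N -> step n i <= t.
Proof. by move=> ?; rewrite -(stepn n) hstep. Qed.

Let stepS n i : step n i.+1 - step n i = t / n.+1%:R.
Proof. by rewrite /step -mulrBl -natr1 [_ + 1]addrC addrK mul1r. Qed.

Let lip_step n i x : (i < n.+1)%N -> step n i < x -> x <= step n i.+1 ->
  `|g x - g (step n i)| <= L * (t / n.+1%:R).
Proof.
move=> ni ux xu.
rewrite (le_trans (gL (step_ge0 n i) (ltW ux) (le_trans xu (step_le ni))))//.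
by rewrite ler_wpM2l// -(stepS n i) lerD2r.
Qed.

Lemma shot_noise_le w : `|shot_noise w| <= M * (N t w)%:R.
Proof.
apply: normr_sum_le_nat => j jN; apply: gM.
by rewrite ltW ?(arrival_gt0 arr)//= AN.
Qed.

(** Each arrival before [t] falls in exactly one step of the partition, on
    which [g] varies by at most [L] times its length. *)
Lemma shot_step_dist n w :
  `|shot_noise w - shot_step n w| <= L * (t / n.+1%:R) * (N t w)%:R.
Proof.
have -> : shot_step n w = \sum_(0 <= j < N t w) \sum_(0 <= i < n.+1)
    g (step n i) * ((A j w <= step n i.+1)%R%:R - (A j w <= step n i)%R%:R).
  rewrite exchange_big/= /shot_step; apply: eq_big_nat => i /andP[_ ni].
  rewrite -mulr_sumr sumrB; congr (_ * _).
  under eq_bigr do rewrite AN//; under [X in _ - X]eq_bigr do rewrite AN//.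
  rewrite !sum_natr_ltn; try by apply: (count_le arr) => //; exact/step_le/ltnW.
  - by rewrite natrB//; apply: (count_le arr) => //; exact: hstep.
  - by apply: (count_le arr) => //; exact: step_le.
rewrite /shot_noise -sumrB.
apply: normr_sum_le_nat => j jN.
have Aj0 := arrival_gt0 arr j w.
have Ajt : A j w <= t by rewrite AN.
have tele : \sum_(0 <= i < n.+1)
    ((A j w <= step n i.+1)%R%:R - (A j w <= step n i)%R%:R) = 1 :> R.
  rewrite (telescope_sumr (fun i => (A j w <= step n i)%R%:R))//.
  by rewrite step0 stepn Ajt leNgt Aj0 subr0.
have splitE (c : R) : c = \sum_(0 <= i < n.+1)
    c * ((A j w <= step n i.+1)%R%:R - (A j w <= step n i)%R%:R).
  by rewrite -mulr_sumr tele mulr1.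
rewrite (splitE (g (A j w))) -sumrB [leRHS]splitE.
apply: (le_trans (ler_norm_sum _ _ _)).
rewrite big_nat_cond [leRHS]big_nat_cond; apply: ler_sum => i /andP[/andP[_ ni] _].
rewrite -mulrBl normrM.
have [Ai|iA] := leP (A j w) (step n i).
  by rewrite (le_trans Ai (hstep n (leqnSn i))) subrr normr0 !mulr0.
have [Ai|_] := leP (A j w) (step n i.+1); last by rewrite subrr normr0 !mulr0.
by rewrite subr0 normr1 !mulr1; exact: lip_step.
Qed.

Lemma count_moments :
  [/\ L1 P (fun w => (N t w)%:R), L1 P (fun w => (N t w)%:R ^+ 2) &
      measurable_fun setT (N t)].
Proof.
(* The whole interval from 0 to [t] as the first step of a partition. *)
pose u i : R := if i is 0%N then 0 else t.
have u0 : 0 <= u 0%N by [].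
have hu : {homo u : i j / (i <= j)%N >-> i <= j} by move=> [|i] [|j].
have uE : increment N u 0 = N t.
  by apply/funext => w; rewrite /increment /= N0 subn0.
have [] := increment_moments f0 arr 0 u0 hu.
have := measurable_increment arr 0 u0 hu.
by rewrite uE.
Qed.

Let fgi : itv_integrable (fun x => f x * g x) := itv_integrableM fi cg.

Let cg2 : continuous (fun x => g x ^+ 2).
Proof.
rewrite (_ : (fun x => _) = (fun x => g x * g x)).
  by move=> x; apply: cvgM; exact: cg.
by apply/funext => x; rewrite expr2.
Qed.

Let fg2i : itv_integrable (fun x => f x * g x ^+ 2) := itv_integrableM fi cg2.

Let L1_increment n i : L1 P (fun w => (increment N (step n) i w)%:R).
Proof. by have [] := increment_moments f0 arr i (step_ge0 n 0) (hstep n). Qed.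

Let L1_increment2 n i j :
  L1 P (fun w => (increment N (step n) i w)%:R * (increment N (step n) j w)%:R).
Proof.
have mi k := @measurable_natr_comp _ T R _ (measurable_increment arr k (step_ge0 n 0) (hstep n)).
have [_ ii _ _] := increment_moments f0 arr i (step_ge0 n 0) (hstep n).
have [_ jj _ _] := increment_moments f0 arr j (step_ge0 n 0) (hstep n).
apply: L1_le (L1D ii jj); first exact: measurable_funM.
move=> w; rewrite ger0_norm ?mulr_ge0//.
by have := sqr_ge0 ((increment N (step n) i w)%:R - (increment N (step n) j w)%:R : R);
  rewrite sqrrB; set x := _%:R; set y := _%:R;
  have := sqr_ge0 x; have := sqr_ge0 y; lra.
Qed.

Let L1_shot_step n : L1 P (shot_step n).
Proof. by apply: L1_sum => i; exact: L1Z. Qed.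

Let shot_step_sqr n w : shot_step n w ^+ 2 =
  \sum_(0 <= i < n.+1) \sum_(0 <= j < n.+1) (g (step n i) * g (step n j)) *
    ((increment N (step n) i w)%:R * (increment N (step n) j w)%:R).
Proof.
rewrite /shot_step expr2 mulr_suml; apply: eq_bigr => i _.
by rewrite mulr_sumr; apply: eq_bigr => j _; ring.
Qed.

Let L1_shot_step2 n : L1 P (fun w => shot_step n w ^+ 2).
Proof.
under [fun w => _]eq_fun do rewrite shot_step_sqr.
by apply: L1_sum => i; apply: L1_sum => j; exact: L1Z.
Qed.

Let mass n i := itv_integral f (step n i) (step n i.+1).

Let mean_shot_step n :
  mean P (shot_step n) = \sum_(0 <= i < n.+1) g (step n i) * mass n i.
Proof.
rewrite /shot_step mean_sum; last by move=> i; exact: L1Z.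
apply: eq_bigr => i _; rewrite meanZ//; congr (_ * _).
by have [] := increment_moments f0 arr i (step_ge0 n 0) (hstep n).
Qed.

Let mean_shot_step2 n : mean P (fun w => shot_step n w ^+ 2) =
  (\sum_(0 <= i < n.+1) g (step n i) * mass n i) ^+ 2
  + \sum_(0 <= i < n.+1) g (step n i) ^+ 2 * mass n i.
Proof.
under [fun w => _]eq_fun do rewrite shot_step_sqr.
rewrite mean_sum; last by move=> i; apply: L1_sum => j; exact: L1Z.
rewrite expr2 mulr_suml -big_split/=; apply: eq_big_nat => i /andP[_ ni].
rewrite mean_sum; last by move=> j; exact: L1Z.
rewrite (eq_bigr (fun j => g (step n i) * mass n i * (g (step n j) * mass n j)
  + (if j == i then g (step n i) ^+ 2 * mass n i else 0))).
  rewrite big_split/= -mulr_sumr; congr (_ + _).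
  by rewrite -big_mkcond/= big_nat1_eq ni.
move=> j _; rewrite meanZ//; have [->|ji] := eqVneq j i.
  have [_ _ _ E] := increment_moments f0 arr i (step_ge0 n 0) (hstep n).
  under [fun w => _]eq_fun do rewrite -expr2.
  by rewrite E -/(mass n i); ring.
rewrite (increment_cross_moment f0 arr (step_ge0 n 0) (hstep n)) 1?eq_sym//.
by rewrite -/(mass n i) -/(mass n j) addr0; ring.
Qed.

Let Lambda := itv_integral f 0 t.

Let Lambda0 : 0 <= Lambda. Proof. exact: Rintegral_ge0. Qed.

Let riemann n : `|itv_integral (fun x => f x * g x) 0 t
  - \sum_(0 <= i < n.+1) g (step n i) * mass n i| <= L * (t / n.+1%:R) * Lambda.
Proof.
have := @riemann_sum_error R f g (step n) n.+1 (L * (t / n.+1%:R)) fi f0 fgi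
  (hstep n) (@lip_step n).
by rewrite step0 stepn.
Qed.

Let riemann2 n : `|itv_integral (fun x => f x * g x ^+ 2) 0 t
  - \sum_(0 <= i < n.+1) g (step n i) ^+ 2 * mass n i|
  <= 2 * M * (L * (t / n.+1%:R)) * Lambda.
Proof.
have := @riemann_sum_error R f (fun x => g x ^+ 2) (step n) n.+1
  (2 * M * (L * (t / n.+1%:R))) fi f0 fg2i (hstep n).
rewrite step0 stepn; apply => i x ni ux xu.
rewrite subr_sqr mulrC normrM ler_pM//; last exact: lip_step.
have -> : 2 * M = M + M by ring.
rewrite (le_trans (ler_normD _ _))// lerD// gM//.
  by rewrite (le_trans (step_ge0 n i) (ltW ux)) (le_trans xu (step_le ni)).
by rewrite step_ge0 step_le// ltnW.
Qed.

Let L1_shot : L1 P shot_noise.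
Proof.
have [iN _ mN] := count_moments.
apply: L1_le (L1Z M iN); last exact: shot_noise_le.
apply: measurable_random_sum => // j.
exact: measurableT_comp (continuous_measurable_fun cg) (mA j).
Qed.

Let L1_shot2 : L1 P (fun w => shot_noise w ^+ 2).
Proof.
have [_ iN2 _] := count_moments.
apply: L1_le (L1Z (M ^+ 2) iN2).
  by apply: measurable_funX; exact: L1_measurable L1_shot.
move=> w; rewrite normrX -exprMn lerXn2r ?nnegrE ?mulr_ge0//; exact: shot_noise_le.
Qed.

Let mean_shot : mean P shot_noise = itv_integral (fun x => f x * g x) 0 t.
Proof.
have [iN _ _] := count_moments.
apply: (@eq_of_le_harmonic _ _ _ (L * t * (mean P (fun w => (N t w)%:R) + Lambda))) => n.
have d1 := mean_dist L1_shot (L1_shot_step n) (L1Z _ iN) (@shot_step_dist n).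
rewrite meanZ// mean_shot_step in d1.
have d2 := riemann n.
rewrite (_ : _ / _ = L * (t / n.+1%:R) * mean P (fun w => (N t w)%:R)
  + L * (t / n.+1%:R) * Lambda); last by ring.
rewrite (le_trans _ (lerD d1 d2))// -[X in _ <= _ + X]normrN opprB.
by rewrite (le_trans _ (ler_normD _ _))// addrA subrK.
Qed.

Let mean_shot2 : mean P (fun w => shot_noise w ^+ 2) =
  itv_integral (fun x => f x * g x) 0 t ^+ 2
  + itv_integral (fun x => f x * g x ^+ 2) 0 t.
Proof.
have [iN iN2 _] := count_moments.
set mN := mean P (fun w => (N t w)%:R).
pose C := L * t * (2 * M * mean P (fun w => (N t w)%:R ^+ 2)
  + 2 * M * mN * Lambda + 2 * M * Lambda).
(* [C / n.+1] collects the errors of the shot noise, of the squared sum and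
   of the sum of squares. *)
apply: (@eq_of_le_harmonic _ _ _ C) => n.
set e := L * (t / n.+1%:R).
have e0 : 0 <= e by rewrite mulr_ge0.
have shot_le w : `|shot_step n w| <= M * (N t w)%:R.
  apply: (le_trans (ler_norm_sum _ _ _)).
  have -> : (N t w)%:R = \sum_(0 <= i < n.+1) (increment N (step n) i w)%:R :> R.
    transitivity (\sum_(0 <= i < n.+1) ((N (step n i.+1) w)%:R - (N (step n i) w)%:R) : R).
      by rewrite (telescope_sumr (fun i => (N (step n i) w)%:R))// stepn step0 N0 subr0.
    apply: eq_bigr => i _; rewrite natrB//; apply: (count_le arr) => //; exact: hstep.
  rewrite mulr_sumr big_nat_cond [leRHS]big_nat_cond.
  apply: ler_sum => i /andP[/andP[_ ni] _].
  by rewrite normrM normr_nat ler_wpM2r// gM// step_ge0 step_le// ltnW.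
have dist2 w : `|shot_noise w ^+ 2 - shot_step n w ^+ 2| <= (2 * M * e) * (N t w)%:R ^+ 2.
  rewrite subr_sqr mulrC normrM.
  have -> : 2 * M * e * (N t w)%:R ^+ 2 =
    (M * (N t w)%:R + M * (N t w)%:R) * (e * (N t w)%:R) by ring.
  rewrite ler_pM//; last exact: shot_step_dist.
  rewrite (le_trans (ler_normD _ _))// lerD//; exact: shot_noise_le.
have d1 := mean_dist L1_shot2 (L1_shot_step2 n) (L1Z _ iN2) dist2.
rewrite meanZ// mean_shot_step2 in d1.
have d2 := riemann n; have d3 := riemann2 n.
have b1 := normr_mean_le L1_shot (L1Z M iN) shot_noise_le.
have b2 := normr_mean_le (L1_shot_step n) (L1Z M iN) shot_le.
rewrite meanZ// mean_shot in b1; rewrite meanZ// mean_shot_step in b2.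
move: d1 d2 d3 b1 b2; rewrite -/e -/mN.
set S := \sum_(0 <= i < n.+1) _ * _; set S2 := \sum_(0 <= i < n.+1) _ * _.
set I := itv_integral _ 0 t; set I2 := itv_integral _ 0 t.
set E2 := mean P _; set EN2 := mean P _ => d1 d2 d3 b1 b2.
have d4 : `|I ^+ 2 - S ^+ 2| <= (e * Lambda) * (M * mN + M * mN).
  by rewrite subr_sqr normrM ler_pM// (le_trans (ler_normD _ _))// lerD.
have -> : C / n.+1%:R = 2 * M * e * EN2 + (e * Lambda) * (M * mN + M * mN)
    + 2 * M * e * Lambda.
  by rewrite /C /e -/EN2; ring.
move: d1 d3 d4; rewrite !ler_norml => /andP[? ?] /andP[? ?] /andP[? ?].
by apply/andP; split; lra.
Qed.

(** On a partition the shot noise is close to a combination of independent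
    Poisson variables, whose variances equal their means: this is where the
    integral of [g ^+ 2] comes from. All errors are of the order of the mesh,
    with constants given by the first two moments of the number of arrivals. *)
Lemma campbell_moments :
  [/\ L1 P shot_noise, L1 P (fun w => shot_noise w ^+ 2),
      mean P shot_noise = itv_integral (fun x => f x * g x) 0 t &
      mean P (fun w => shot_noise w ^+ 2) =
        itv_integral (fun x => f x * g x) 0 t ^+ 2
        + itv_integral (fun x => f x * g x ^+ 2) 0 t].
Proof. by []. Qed.

End campbell.

(** * Second moments of sums of indicators *)

Section moments.
Context d (T : measurableType d) (R : realType) (P : probability T R).
Implicit Types X Y : T -> R.

Lemma expectation_mean X : L1 P X -> ('E_P[X] = (mean P X)%:E)%E.
Proof.
by move=> iX; rewrite unlock /mean /Rintegral fineK//; exact: integrable_fin_num.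
Qed.

Lemma variance_mean X : L1 P X -> L1 P (fun w => X w ^+ 2) ->
  ('V_P[X] = (mean P (fun w => X w ^+ 2)%R - mean P X ^+ 2)%:E)%E.
Proof.
move=> iX iX2; rewrite /variance unlock (expectation_mean iX)/=.
set m := mean P X.
rewrite (_ : (_ * _)%R = (fun w => X w ^+ 2 + ((- (2 * m)) * X w + cst (m ^+ 2) w))); last first.
  by apply/funext => w /=; rewrite !fctE /=; ring.
have i1 := L1Z (- (2 * m)) iX; have i2 := L1D i1 (L1_cst P (m ^+ 2)).
rewrite expectation_mean; last exact: L1D.
rewrite meanD// meanD//; last exact: L1_cst.
by rewrite meanZ// mean_cst -/m; congr _%:E; ring.
Qed.

(** Outside the diagonal the two double sums have equal expectations. On the
    diagonal an indicator is its own square, which replaces the expectation of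
    the square of [Y i] by that of [Y i] itself. *)
Lemma mean_sum_sqr (I : eqType) (s : seq I) (X Y : I -> T -> R) : uniq s ->
  (forall i, L1 P (X i)) -> (forall i, L1 P (Y i)) ->
  (forall i j, L1 P (fun w => X i w * X j w)) ->
  (forall i j, L1 P (fun w => Y i w * Y j w)) ->
  (forall i w, X i w * X i w = X i w) ->
  (forall i, mean P (X i) = mean P (Y i)) ->
  (forall i j, i != j ->
    mean P (fun w => X i w * X j w) = mean P (fun w => Y i w * Y j w)) ->
  mean P (fun w => (\sum_(i <- s) X i w) ^+ 2) =
  mean P (fun w => (\sum_(i <- s) Y i w) ^+ 2) + mean P (fun w => \sum_(i <- s) Y i w)
  - mean P (fun w => \sum_(i <- s) Y i w ^+ 2).
Proof.
move=> us iX iY iXX iYY XX XY XXYY.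
have sqrE (Z : I -> T -> R) : (fun w => (\sum_(i <- s) Z i w) ^+ 2) =
    fun w => \sum_(i <- s) \sum_(j <- s) Z i w * Z j w.
  apply/funext => w; rewrite expr2 mulr_suml; apply: eq_bigr => i _.
  by rewrite mulr_sumr.
have meanE (Z : I -> T -> R) : (forall i j, L1 P (fun w => Z i w * Z j w)) ->
    mean P (fun w => (\sum_(i <- s) Z i w) ^+ 2) =
    \sum_(i <- s) \sum_(j <- s) mean P (fun w => Z i w * Z j w).
  move=> iZ; rewrite sqrE mean_sum; last by move=> i; exact: L1_sum.
  by apply: eq_bigr => i _; rewrite mean_sum.
rewrite !meanE// mean_sum// (@mean_sum _ _ _ P _ s (fun i w => Y i w ^+ 2)); last first.
  move=> i; under [fun w => _]eq_fun do rewrite expr2; exact: iYY.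
rewrite -big_split -sumrB/= big_seq [RHS]big_seq; apply: eq_bigr => i si.
have -> : (fun w => Y i w ^+ 2) = (fun w => Y i w * Y i w).
  by apply/funext => w; rewrite expr2.
rewrite !(bigD1_seq i)//= (eq_bigr (fun j => mean P (fun w => Y i w * Y j w))).
  by rewrite (_ : (fun w => X i w * X i w) = X i) ?XY; [ring|exact/funext].
by move=> j ji; rewrite XXYY// eq_sym.
Qed.

End moments.

Section customers.
Variables (q0 n : nat).

(** The initial customers and the members of the first [J] batches. The finite
    truncation makes all sums over customers finite and independent of the
    random number of arrivals. *)
Definition customers (J : nat) : seq (customer q0 n) :=
  [seq inl i | i <- enum 'I_q0] ++ [seq inr (j, i) | j <- iota 0 J, i <- enum 'I_n].

Lemma uniq_customers J : uniq (customers J).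
Proof.
rewrite cat_uniq map_inj_uniq ?enum_uniq//=; last by move=> i j [].
rewrite allpairs_uniq ?iota_uniq ?enum_uniq//; last by move=> [a b] [c d'] _ _ /= [-> ->].
rewrite andbT; apply/hasPn => c /allpairsP[[j i] [_ _ ->]] /=.
by apply/negP => /mapP[].
Qed.

Lemma sum_customers (R : realType) (F : customer q0 n -> R) (J : nat) :
  \sum_(c <- customers J) F c =
  \sum_(i < q0) F (inl i) + \sum_(0 <= j < J) \sum_(i < n) F (inr (j, i)).
Proof.
rewrite big_cat/= big_map big_enum/=; congr (_ + _).
rewrite big_allpairs_dep/= /index_iota subn0; apply: eq_bigr => j _.
by rewrite big_enum.
Qed.

End customers.

(** * The number in system *)

(** The regularity that Campbell's formulas require of the weights. *)
Lemma survival_kernel_facts (R : realType) (m t : R) : 0 <= m ->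
  let g x := expR (- m * (t - x)) in
  [/\ continuous g, forall x, 0 <= x <= t -> `|g x| <= 1 &
      forall x y, 0 <= x -> x <= y -> y <= t -> `|g y - g x| <= m * (y - x)].
Proof.
move=> m0 g; split.
- rewrite (_ : g = fun x => expR (- m * t) * expR (m * x)).
    by move=> x; apply: cvgM; [exact: cvg_cst|exact: continuous_expRM].
  by apply/funext => x; rewrite /g -expRD; congr expR; ring.
- move=> x /andP[_ xt]; rewrite ger0_norm ?expR_ge0// -expR0 ler_expR mulNr oppr_le0.
  by rewrite mulr_ge0// subr_ge0.
- move=> x y _ xy yt.
  have -> : g y - g x = g y * (1 - expR (- (m * (y - x)))).
    by rewrite mulrBr mulr1 /g -expRD; congr (_ - expR _); ring.
  have e1 : expR (- (m * (y - x))) <= 1.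
    by rewrite -expR0 ler_expR oppr_le0 mulr_ge0// subr_ge0.
  have g1 : g y <= 1.
    by rewrite /g -expR0 ler_expR mulNr oppr_le0 mulr_ge0// subr_ge0.
  rewrite ger0_norm ?mulr_ge0 ?expR_ge0 ?subr_ge0//.
  apply: (@le_trans _ _ (1 - expR (- (m * (y - x))))).
    by rewrite ler_piMl// subr_ge0.
  by have := expR_ge1Dx (- (m * (y - x))); lra.
Qed.

Lemma sum_customers_le (R : realType) (q0 n J K : nat) (F : customer q0 n -> R) :
  (forall c, `|F c| <= 1) -> (forall j i, (K <= j)%N -> F (inr (j, i)) = 0) ->
  `|\sum_(c <- customers q0 n J) F c| <= q0%:R + n%:R * K%:R.
Proof.
move=> F1 FK; rewrite sum_customers (le_trans (ler_normD _ _))// lerD//.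
  rewrite (le_trans (ler_norm_sum _ _ _))//.
  apply: (@le_trans _ _ (\sum_(i < q0) 1)).
    by apply: ler_sum => i _; exact: F1.
  by rewrite sumr_const card_ord.
apply: (@le_trans _ _ (\sum_(0 <= j < J) n%:R * (j < K)%N%:R)).
  apply: (le_trans (ler_norm_sum _ _ _)); apply: ler_sum => j _.
  rewrite (le_trans (ler_norm_sum _ _ _))//.
  apply: (@le_trans _ _ (\sum_(i < n) (j < K)%N%:R)).
    apply: ler_sum => i _.
    by case: ltnP => [_|Kj]; [exact: F1|rewrite FK// normr0].
  by rewrite sumr_const card_ord mulr_natl.
rewrite -mulr_sumr ler_wpM2l//.
have [JK|KJ] := leqP J K; last by rewrite sum_natr_ltn// ltnW.
apply: (@le_trans _ _ (\sum_(0 <= j < J) 1)).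
  by apply: ler_sum => j _; case: ltnP.
by rewrite sumr_const_nat subn0 ler_nat.
Qed.

Section queue.
Context d (T : measurableType d) (R : realType) (P : probability T R).
Variables (f : R -> R) (n : nat) (mu : R) (q0 : nat) (t : R).
Variables (A : nat -> T -> R) (N : R -> T -> nat) (S : customer q0 n -> T -> R).
Hypothesis fi : itv_integrable f.
Hypothesis f0 : forall x, 0 <= f x.
Hypothesis mu0 : 0 < mu.
Hypothesis arr : poisson_arrivals P f A N.
Hypothesis serv : exponential_services P mu A S.
Hypothesis t0 : 0 <= t.

(** With 0 for the initial customers, whose remaining service times are also
    exponential, all customers are treated alike. *)
Definition arrival_time (c : customer q0 n) : T -> R :=
  match c with inl _ => cst 0 | inr (j, _) => A j end.

Definition in_system (c : customer q0 n) (w : T) : R :=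
  (present t (arrival_time c w) (S c w))%:R.

(** The probability of being in the system at time [t], given all arrival
    times. *)
Definition conditional_presence (c : customer q0 n) (w : T) : R :=
  survival mu t (arrival_time c w).

Let SE c B : measurable B -> P (S c @^-1` B) = exponential_prob mu B.
Proof. by case: serv => H _; exact: H. Qed.

Let mS c : measurable_fun setT (S c).
Proof.
case: serv => _ [/(_ (Some c)) H _] _ B mB.
by apply: H; exists B.
Qed.

Let arrival_sigma (X : T -> R * R) :
  measurable_fun (setT : set (g_sigma_algebraType (\bigcup_j sigma_of (A j)))) X ->
  forall B, measurable B -> sigma_of_seq A (X @^-1` B).
Proof. by move=> mX B mB; rewrite -[X @^-1` B]setTI; exact: (mX measurableT B mB). Qed.

Let mA_sigma j :
  measurable_fun (setT : set (g_sigma_algebraType (\bigcup_j sigma_of (A j)))) (A j).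
Proof.
move=> _ B mB; apply: sub_sigma_algebra; exists j => //.
by exists B.
Qed.

Let mA j : measurable_fun setT (A j).
Proof.
move=> _ B mB; case: serv => _ [/(_ None) H _].
by apply: H; exact: mA_sigma.
Qed.

Let mat_sigma c :
  measurable_fun (setT : set (g_sigma_algebraType (\bigcup_j sigma_of (A j))))
    (arrival_time c).
Proof. by case: c => [i|[j i]] /=; [exact: measurable_cst|exact: mA_sigma]. Qed.

Let mat c : measurable_fun setT (arrival_time c).
Proof. by case: c => [i|[j i]] /=; [exact: measurable_cst|exact: mA]. Qed.

Let independent_pair c c' (B : set (R * R)) C D : c != c' ->
  measurable B -> measurable C -> measurable D ->
  P ((fun w => (arrival_time c w, arrival_time c' w)) @^-1` B
     `&` (S c @^-1` C `&` S c' @^-1` D)) =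
  (P ((fun w => (arrival_time c w, arrival_time c' w)) @^-1` B)
   * (P (S c @^-1` C) * P (S c' @^-1` D)))%E.
Proof.
move=> cc' mB mC mD; case: serv => _ [meas ind].
set X := fun w => (arrival_time c w, arrival_time c' w).
have sX : sigma_of_seq A (X @^-1` B).
  by apply: arrival_sigma => //; exact: measurable_fun_pair.
have mXB : measurable (X @^-1` B) by exact: (meas None).
have mSC := measurable_preimage (mS c) mC.
have mSD := measurable_preimage (mS c') mD.
pose E (o : option (customer q0 n)) := match o with
  | None => X @^-1` B
  | Some e => if e == c then S c @^-1` C else S c' @^-1` D end.
have c'c : c' == c = false by rewrite eq_sym; exact: negbTE.
have := ind [:: None; Some c; Some c'] E.
rewrite !big_cons big_nil mulr1 /= eqxx c'c !EFinM !fineK ?fin_num_measure//.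
move=> <-.
- congr (P _); apply/seteqP; split => w /=.
    move=> [XB [SC SD]] o; rewrite /= !inE => /or3P[] /eqP -> //=.
      by rewrite eqxx.
    by rewrite c'c.
  move=> H; split; first exact: (H None).
  split; first by have := H (Some c); rewrite /= !inE !eqxx; apply.
  by have := H (Some c'); rewrite /= !inE eqxx !orbT c'c; apply.
- by rewrite !inE; apply/andP.
- move=> o; rewrite !inE => /or3P[] /eqP -> //=.
    by rewrite eqxx; exists C => //; rewrite setTI.
  by rewrite c'c; exists D => //; rewrite setTI.
Qed.

Let independent_one c (B C : set R) : measurable B -> measurable C ->
  P (arrival_time c @^-1` B `&` S c @^-1` C) =
  (P (arrival_time c @^-1` B) * P (S c @^-1` C))%E.
Proof.
move=> mB mC; case: serv => _ [meas ind].
have sB : sigma_of_seq A (arrival_time c @^-1` B).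
  by rewrite -[_ @^-1` B]setTI; exact: (mat_sigma c measurableT mB).
have mXB : measurable (arrival_time c @^-1` B) by exact: (meas None).
have mSC := measurable_preimage (mS c) mC.
pose E (o : option (customer q0 n)) := match o with
  | None => arrival_time c @^-1` B
  | Some e => S c @^-1` C end.
have := ind [:: None; Some c] E.
rewrite !big_cons big_nil mulr1 /= EFinM !fineK ?fin_num_measure//.
move=> <-//.
- congr (P _); apply/seteqP; split => w /=.
    by move=> [XB SC] o; rewrite /= !inE => /orP[] /eqP ->.
  move=> H; split; first exact: (H None).
  by have := H (Some c); rewrite /= !inE !eqxx; apply.
- move=> o; rewrite !inE => /orP[] /eqP -> //=.
  by exists C => //; rewrite setTI.
Qed.

Let m_in c : measurable_fun setT (in_system c).
Proof.
rewrite /in_system (_ : (fun w => _) = (fun z : R * R => (present t z.1 z.2)%:R : R)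
  \o (fun w => (arrival_time c w, S c w)))//.
by apply: measurableT_comp; [exact: measurable_present|exact: measurable_fun_pair].
Qed.

Let m_cond c : measurable_fun setT (conditional_presence c).
Proof. exact: measurableT_comp (measurable_survival mu t) (mat c). Qed.

Let in1 c w : `|in_system c w| <= 1.
Proof. by rewrite /in_system normr_nat; case: present. Qed.

Let cond1 c w : `|conditional_presence c w| <= 1.
Proof. by rewrite ger0_norm ?survival_ge0// survival_le1. Qed.

Let L1_bounded (X : T -> R) : measurable_fun setT X -> (forall w, `|X w| <= 1) -> L1 P X.
Proof. by move=> mX X1; exact: L1_le mX X1 (L1_cst P 1). Qed.

Let normM1 (x y : R) : `|x| <= 1 -> `|y| <= 1 -> `|x * y| <= 1.
Proof. by move=> x1 y1; rewrite normrM mulr_ile1. Qed.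

(** Given the arrival times, the presences of different customers are
    independent, so that their mixed moments are those of the conditional
    probabilities. *)
Lemma truncated_moments J :
  mean P (fun w => \sum_(c <- customers q0 n J) in_system c w) =
    mean P (fun w => \sum_(c <- customers q0 n J) conditional_presence c w) /\
  mean P (fun w => (\sum_(c <- customers q0 n J) in_system c w) ^+ 2) =
    mean P (fun w => (\sum_(c <- customers q0 n J) conditional_presence c w) ^+ 2)
    + mean P (fun w => \sum_(c <- customers q0 n J) conditional_presence c w)
    - mean P (fun w => \sum_(c <- customers q0 n J) conditional_presence c w ^+ 2).
Proof.
have m1 c : mean P (in_system c) = mean P (conditional_presence c).
  exact: (presence_mean t mu0 (mat c) (mS c) (@SE c) (@independent_one c)).
have iI c : L1 P (in_system c) by exact: L1_bounded.
have iC c : L1 P (conditional_presence c) by exact: L1_bounded.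
split; first by rewrite !mean_sum//; apply: eq_bigr.
apply: mean_sum_sqr => //.
- exact: uniq_customers.
- by move=> c c'; apply: L1_bounded => [|w]; [exact: measurable_funM|exact: normM1].
- by move=> c c'; apply: L1_bounded => [|w]; [exact: measurable_funM|exact: normM1].
- by move=> c w; rewrite /in_system -natrM mulnb andbb.
- move=> c c' cc'; apply: (presence_mean2 t mu0 (mat c) (mat c') (mS c) (mS c') (@SE c) (@SE c')).
  by move=> B C D mB mC mD; exact: independent_pair.
Qed.


Let g x := expR (- mu * (t - x)).
Let g2 x := expR (- (2 * mu) * (t - x)).

Let AN s j w : 0 <= s -> (A j w <= s) = (j < N s w)%N.
Proof. by case: arr => _ H _ _; exact: H. Qed.

Let sum_condE (b : R) (h : R -> R) (F : customer q0 n -> T -> R) :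
  (forall i w, F (inl i) w = b) ->
  (forall j i w, F (inr (j, i)) w = (A j w <= t)%R%:R * h (A j w)) ->
  forall J w, \sum_(c <- customers q0 n J) F c w =
    q0%:R * b + \sum_(0 <= j < J) (j < N t w)%N%:R * (n%:R * h (A j w)).
Proof.
move=> Fb Fh J w; rewrite sum_customers; congr (_ + _).
  under eq_bigr do rewrite Fb.
  by rewrite sumr_const card_ord mulr_natl.
apply: eq_bigr => j _; under eq_bigr do rewrite Fh AN//.
by rewrite sumr_const card_ord -mulrnAr [n%:R * _]mulr_natl.
Qed.

Let sum_cond J w : \sum_(c <- customers q0 n J) conditional_presence c w =
    q0%:R * g 0 + \sum_(0 <= j < J) (j < N t w)%N%:R * (n%:R * g (A j w)).
Proof. by apply: sum_condE => // i v; rewrite /conditional_presence /survival t0 mul1r. Qed.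

Let sum_cond2 J w : \sum_(c <- customers q0 n J) conditional_presence c w ^+ 2 =
    q0%:R * g2 0 + \sum_(0 <= j < J) (j < N t w)%N%:R * (n%:R * g2 (A j w)).
Proof.
have gg x : g x ^+ 2 = g2 x.
  by rewrite /g /g2 expr2 -expRD; congr expR; ring.
apply: (@sum_condE _ g2 (fun c w => conditional_presence c w ^+ 2)).
- by move=> i v; rewrite /conditional_presence /survival t0 mul1r -gg.
- move=> j i v; rewrite /conditional_presence /survival /= exprMn -gg.
  by case: (A j v <= t); rewrite ?expr1n ?expr0n.
Qed.

Let Qt : T -> nat := number_in_system A N S t.

Let cvg_in w : (fun J => \sum_(c <- customers q0 n J) in_system c w) @ \oo -->
  ((Qt w)%:R : R).
Proof.
rewrite (_ : (fun J => _) = fun J => \sum_(i < q0) (t < S (inl i) w)%R%:R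
  + \sum_(0 <= j < J) (j < N t w)%N%:R *
      \sum_(i < n) (t < A j w + S (inr (j, i)) w)%R%:R); last first.
  apply/funext => J; rewrite sum_customers; congr (_ + _).
    by apply: eq_bigr => i _; rewrite /in_system /present /= t0 add0r.
  apply: eq_bigr => j _; rewrite mulr_sumr; apply: eq_bigr => i _.
  by rewrite /in_system /present /= AN// -natrM mulnb.
rewrite /Qt /number_in_system natrD !natr_sum; apply: cvgD; first exact: cvg_cst.
under [X in _ --> X]eq_bigr do rewrite natr_sum.
rewrite -(big_mkord xpredT
  (fun j => \sum_(i < n) (t < A j w + S (inr (j, i)) w)%R%:R)).
exact: cvg_random_sum.
Qed.

Let cvg_cond w : (fun J => \sum_(c <- customers q0 n J) conditional_presence c w)
  @ \oo --> q0%:R * g 0 + n%:R * shot_noise A N t g w.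
Proof.
under eq_fun do rewrite sum_cond.
rewrite /shot_noise mulr_sumr; apply: cvgD; first exact: cvg_cst.
exact: cvg_random_sum.
Qed.

Let cvg_cond2 w : (fun J => \sum_(c <- customers q0 n J) conditional_presence c w ^+ 2)
  @ \oo --> q0%:R * g2 0 + n%:R * shot_noise A N t g2 w.
Proof.
under eq_fun do rewrite sum_cond2.
rewrite /shot_noise mulr_sumr; apply: cvgD; first exact: cvg_cst.
exact: cvg_random_sum.
Qed.

Let bound w : R := q0%:R + n%:R * (N t w)%:R.

Let L1_bound : L1 P bound.
Proof.
have [iN _ _] := count_moments f0 arr t0.
exact: L1D (L1_cst P _) (L1Z _ iN).
Qed.

Let L1_bound2 : L1 P (fun w => bound w ^+ 2).
Proof.
have [iN iN2 _] := count_moments f0 arr t0.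
rewrite (_ : (fun w => _) = fun w => q0%:R ^+ 2 +
    (2 * q0%:R * n%:R * (N t w)%:R + n%:R ^+ 2 * (N t w)%:R ^+ 2)).
  by apply: L1D; [exact: L1_cst|apply: L1D; exact: L1Z].
by apply/funext => w; rewrite /bound; ring.
Qed.

Let late0 j i w : (N t w <= j)%N -> conditional_presence (inr (j, i)) w = 0.
Proof.
by move=> Nj; rewrite /conditional_presence /survival /= AN// ltnNge Nj mul0r.
Qed.

Let in_le J w : `|\sum_(c <- customers q0 n J) in_system c w| <= bound w.
Proof.
apply: sum_customers_le => [c|j i Nj]; first exact: in1.
by rewrite /in_system /present /= AN// ltnNge Nj.
Qed.

Let cond_le J w : `|\sum_(c <- customers q0 n J) conditional_presence c w| <= bound w.
Proof. by apply: sum_customers_le => [c|j i Nj]; [exact: cond1|exact: late0]. Qed.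

Let cond2_le J w :
  `|\sum_(c <- customers q0 n J) conditional_presence c w ^+ 2| <= bound w.
Proof.
apply: (@sum_customers_le _ _ _ _ _ (fun c => conditional_presence c w ^+ 2)).
  by move=> c; rewrite expr2; exact: normM1.
by move=> j i Nj; rewrite late0// expr0n.
Qed.

Let sqr_le (x y : R) : `|x| <= y -> `|x ^+ 2| <= y ^+ 2.
Proof.
by move=> xy; rewrite normrX lerXn2r// nnegrE// (le_trans _ xy).
Qed.

Let cvg_sqr (u : nat -> R) (l : R) : u @ \oo --> l -> (fun J => u J ^+ 2) @ \oo --> l ^+ 2.
Proof.
move=> ul; rewrite (_ : (fun J => _) = fun J => u J * u J); first exact: cvgM.
by apply/funext => J; rewrite expr2.
Qed.

Let m_inJ J : measurable_fun setT (fun w => \sum_(c <- customers q0 n J) in_system c w).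
Proof. by apply: measurable_sum => c; exact: m_in. Qed.

Let m_condJ J :
  measurable_fun setT (fun w => \sum_(c <- customers q0 n J) conditional_presence c w).
Proof. by apply: measurable_sum => c; exact: m_cond. Qed.

Let m_cond2J J : measurable_fun setT
  (fun w => \sum_(c <- customers q0 n J) conditional_presence c w ^+ 2).
Proof. by apply: measurable_sum => c; apply: measurable_funX; exact: m_cond. Qed.

Let mQ : measurable_fun setT (fun w => (Qt w)%:R : R).
Proof. by apply: (measurable_fun_cvg m_inJ) => w _; exact: cvg_in. Qed.

Let Q_le w : `|(Qt w)%:R| <= bound w.
Proof.
exact: (normr_limit_le (@cvg_in w) (fun J => in_le J w)).
Qed.

Let L1_Q : L1 P (fun w => (Qt w)%:R).
Proof. exact: L1_le mQ Q_le L1_bound. Qed.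

Let L1_Q2 : L1 P (fun w => (Qt w)%:R ^+ 2).
Proof. exact: L1_le (measurable_funX 2 mQ) (fun w => sqr_le (Q_le w)) L1_bound2. Qed.

(** As [J] grows the truncated sums are eventually constant at each sample
    point, and [q0 + n * N t] dominates them all. The limits of the sums of
    conditional probabilities are shot noises. *)
Lemma number_in_system_moments :
  let I1 := itv_integral (fun x => f x * g x) 0 t in
  let I2 := itv_integral (fun x => f x * g2 x) 0 t in
  [/\ L1 P (fun w => (Qt w)%:R), L1 P (fun w => (Qt w)%:R ^+ 2),
      mean P (fun w => (Qt w)%:R) = q0%:R * g 0 + n%:R * I1 &
      mean P (fun w => (Qt w)%:R ^+ 2) = (q0%:R * g 0 + n%:R * I1) ^+ 2
        + n%:R ^+ 2 * I2 + (q0%:R * g 0 + n%:R * I1) - (q0%:R * g2 0 + n%:R * I2)].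
Proof.
move=> I1 I2.
have [cg g1 gL] := survival_kernel_facts t (ltW mu0).
have [cg2 g21 g2L] := survival_kernel_facts t (mulr_ge0 (ler0n R 2) (ltW mu0)).
have [sh1 sh2 msh msh2] := campbell_moments fi f0 arr mA t0 cg (ltW mu0) g1 gL.
have [sh21 _ msh21 _] := campbell_moments fi f0 arr mA t0 cg2
  (mulr_ge0 (ler0n R 2) (ltW mu0)) g21 g2L.
have gg : (fun x => f x * expR (- mu * (t - x)) ^+ 2) = (fun x => f x * g2 x).
  by apply/funext => x; congr (_ * _); rewrite /g2 expr2 -expRD; congr expR; ring.
rewrite gg in msh2.
have mI : mean P (fun w => q0%:R * g 0 + n%:R * shot_noise A N t g w) =
    q0%:R * g 0 + n%:R * I1.
  rewrite (meanD (L1_cst P _) (L1Z _ sh1)).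
  by rewrite mean_cst (meanZ _ sh1) msh.
have mI2 : mean P (fun w => q0%:R * g2 0 + n%:R * shot_noise A N t g2 w) =
    q0%:R * g2 0 + n%:R * I2.
  rewrite (meanD (L1_cst P _) (L1Z _ sh21)).
  by rewrite mean_cst (meanZ _ sh21) msh21.
have mII : mean P (fun w => (q0%:R * g 0 + n%:R * shot_noise A N t g w) ^+ 2) =
    (q0%:R * g 0 + n%:R * I1) ^+ 2 + n%:R ^+ 2 * I2.
  rewrite (_ : (fun w => _) = fun w => (q0%:R * g 0) ^+ 2 +
    (2 * (q0%:R * g 0) * n%:R * shot_noise A N t g w
     + n%:R ^+ 2 * shot_noise A N t g w ^+ 2)); last by apply/funext => w; ring.
  rewrite (meanD (L1_cst P ((q0%:R * g 0) ^+ 2)) (L1D (L1Z _ sh1) (L1Z _ sh2))).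
  rewrite (mean_cst P ((q0%:R * g 0) ^+ 2)) (meanD (L1Z _ sh1) (L1Z _ sh2)) (meanZ _ sh1) (meanZ _ sh2) msh msh2.
  by rewrite -/I1 -/I2; ring.
have msn (h : R -> R) : L1 P (shot_noise A N t h) -> forall b : R,
    measurable_fun setT (fun w => b + n%:R * shot_noise A N t h w).
  move=> hi b; apply: (@L1_measurable _ _ _ P).
  by apply: L1D; [exact: L1_cst|exact: L1Z].
have l1 := @mean_dominated _ _ _ P _ _ _ m_inJ mQ (@cvg_in) L1_bound in_le.
have l2 := @mean_dominated _ _ _ P _ _ _ m_condJ (msn _ sh1 _) (@cvg_cond) L1_bound cond_le.
have l3 := @mean_dominated _ _ _ P _ _ _ m_cond2J (msn _ sh21 _) (@cvg_cond2) L1_bound cond2_le.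
have l4 := @mean_dominated _ _ _ P _ _ _ (fun J => measurable_funX 2 (m_inJ J)) (measurable_funX 2 mQ)
  (fun w => cvg_sqr (@cvg_in w)) L1_bound2 (fun J w => sqr_le (in_le J w)).
have l5 := @mean_dominated _ _ _ P _ _ _ (fun J => measurable_funX 2 (m_condJ J))
  (measurable_funX 2 (msn _ sh1 _))
  (fun w => cvg_sqr (@cvg_cond w)) L1_bound2 (fun J w => sqr_le (cond_le J w)).
have E1 : (fun J => mean P (fun w => \sum_(c <- customers q0 n J) in_system c w)) =
    fun J => mean P (fun w => \sum_(c <- customers q0 n J) conditional_presence c w).
  by apply/funext => J; have [] := truncated_moments J.
have E2 : (fun J => mean P (fun w => (\sum_(c <- customers q0 n J) in_system c w) ^+ 2)) =
    fun J =>
      mean P (fun w => (\sum_(c <- customers q0 n J) conditional_presence c w) ^+ 2)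
      + mean P (fun w => \sum_(c <- customers q0 n J) conditional_presence c w)
      - mean P (fun w => \sum_(c <- customers q0 n J) conditional_presence c w ^+ 2).
  by apply/funext => J; have [] := truncated_moments J.
rewrite E1 in l1; rewrite E2 in l4.
split; [exact: L1_Q|exact: L1_Q2| |].
- by rewrite -mI; exact: (cvg_unique (@Rhausdorff R) l1 l2).
- rewrite -mII -mI -mI2.
  exact: (cvg_unique (@Rhausdorff R) l4 (cvgB (cvgD l5 l2) l3)).
Qed.

End queue.

(** * The mean and the variance of the queue *)

Lemma summable_from1Z (R : realType) (c : R) (u : nat -> R) : summable_from1 u ->
  summable_from1 (fun k => c * u k) /\ sum_from1 (fun k => c * u k) = c * sum_from1 u.
Proof.
move=> su; have cu : (fun m => \sum_(1 <= k < m) c * u k) @ \oo --> c * sum_from1 u.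
  under eq_fun do rewrite -mulr_sumr.
  by apply: cvgM; [exact: cvg_cst|exact: su].
by split; [apply/cvg_ex; eexists; exact: cu|exact: cvg_lim cu].
Qed.

Theorem corollary2p3 (d : measure_display) (T : measurableType d)
    (R : realType) (P : probability T R)
    (f : R -> R) (lambda : R) (a b : nat -> R)
    (n : nat) (mu : R) (q0 : nat) (Q : R -> T -> nat)
    (f_gt0 : forall x, 0 < f x)
    (f_locint : locally_integrable [set: R] f)
    (f_periodic : periodic f (2 * pi))
    (f_fourier : has_fourier_series f lambda a b)
    (n_gt0 : (0 < n)%N)
    (mu_gt0 : 0 < mu)
    (Q_queue : batch_infinite_server_queue P f n mu q0 Q)
    (t : R) (t_ge0 : 0 <= t) :
  let C1 (k : nat) := n%:R * (a k * mu - b k * k%:R) / (k%:R ^+ 2 + mu ^+ 2)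
                      * (cos (k%:R * t) - expR (- mu * t)) in
  let S1 (k : nat) := n%:R * (a k * k%:R + b k * mu) / (k%:R ^+ 2 + mu ^+ 2)
                      * sin (k%:R * t) in
  let C2 (k : nat) := n%:R * (n%:R - 1) * (2 * a k * mu - b k * k%:R)
                      / (k%:R ^+ 2 + 4 * mu ^+ 2)
                      * (cos (k%:R * t) - expR (- 2 * mu * t)) in
  let S2 (k : nat) := n%:R * (n%:R - 1) * (a k * k%:R + 2 * b k * mu)
                      / (k%:R ^+ 2 + 4 * mu ^+ 2)
                      * sin (k%:R * t) in
  [/\ [/\ summable_from1 C1, summable_from1 S1,
          summable_from1 C2 & summable_from1 S2],
      'E_P[fun w => (Q t w)%:R]%E =
        (q0%:R * expR (- mu * t)
         + n%:R * lambda / mu * (1 - expR (- mu * t))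
         + sum_from1 C1
         + sum_from1 S1)%:E
    & 'V_P[fun w => (Q t w)%:R]%E =
        (q0%:R * (expR (- mu * t) - expR (- 2 * mu * t))
         + n%:R * lambda / mu * (1 - expR (- mu * t))
         + sum_from1 C1
         + sum_from1 S1
         + n%:R * (n%:R - 1) * lambda / (2 * mu) * (1 - expR (- 2 * mu * t))
         + sum_from1 C2
         + sum_from1 S2)%:E].
Proof.
move=> C1 S1 C2 S2.
have fi := locally_itv_integrable f_locint.
have fge0 x : 0 <= f x := ltW (f_gt0 x).
have mu2_gt0 : 0 < 2 * mu by rewrite mulr_gt0.
have [c1 s1 I1E] := fourier_conv_expR mu_gt0 t_ge0 fi f_periodic f_fourier.
have [c2 s2 I2E] := fourier_conv_expR mu2_gt0 t_ge0 fi f_periodic f_fourier.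
have C1E : C1 = fun k => n%:R *
    (conv_cos_coef mu a b k * (cos (k%:R * t) - expR (- mu * t))).
  by apply/funext => k; rewrite /C1 /conv_cos_coef; ring.
have S1E : S1 = fun k => n%:R * (conv_sin_coef mu a b k * sin (k%:R * t)).
  by apply/funext => k; rewrite /S1 /conv_sin_coef; ring.
have e2 : - (2 * mu) * t = - 2 * mu * t by ring.
have d2 k : k%:R ^+ 2 + 4 * mu ^+ 2 = k%:R ^+ 2 + (2 * mu) ^+ 2 :> R by ring.
have C2E : C2 = fun k => (n%:R * (n%:R - 1)) *
    (conv_cos_coef (2 * mu) a b k * (cos (k%:R * t) - expR (- (2 * mu) * t))).
  by apply/funext => k; rewrite /C2 /conv_cos_coef d2 e2; ring.
have S2E : S2 = fun k => (n%:R * (n%:R - 1)) *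
    (conv_sin_coef (2 * mu) a b k * sin (k%:R * t)).
  by apply/funext => k; rewrite /S2 /conv_sin_coef d2; ring.
have [sc1 sumc1] := summable_from1Z n%:R c1.
have [ss1 sums1] := summable_from1Z n%:R s1.
have [sc2 sumc2] := summable_from1Z (n%:R * (n%:R - 1)) c2.
have [ss2 sums2] := summable_from1Z (n%:R * (n%:R - 1)) s2.
rewrite C1E S1E C2E S2E sumc1 sums1 sumc2 sums2.
case: Q_queue => A [N [S [arr serv QE]]].
have QtE : (fun w => (Q t w)%:R) = (fun w => (number_in_system A N S t w)%:R : R).
  by apply/funext => w; rewrite QE.
have [iQ iQ2 mQ mQ2] := number_in_system_moments fi fge0 mu_gt0 arr serv t_ge0.
split; first by split.
- rewrite QtE expectation_mean// mQ I1E subr0; congr _%:E; ring.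
- rewrite QtE variance_mean// mQ2 mQ I1E I2E !subr0 e2; congr _%:E.
  field.
  by rewrite gt_eqF.
Qed.
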